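(* Let $X$ be a discretely geodesic metric space such that all bounded subsets of $X$ are finite. If $X$ has $\beta$-stable intervals for some constant $\beta \ge 0$, then the injective hull $\mathrm{E}(X)$ is proper (bounded closed subsets are compact) and has the structure of a locally finite polyhedral complex with only finitely many isometry types of $n$-cells, each isometric to an injective (convex, compact) polytope in $l^n_\infty$, for every $n \ge 1$.
   Context: A metric space $Y$ is injective if for every metric space $B$, every $A\subset B$ and every 1-Lipschitz map $f\colon A\to Y$ there is a 1-Lipschitz extension $B\to Y$. For a metric space $(X,d)$, let $\Delta(X)=\{f\colon X\to\mathbb{R} : f(x)+f(y)\ge d(x,y)\ \forall x,y\in X\}$, partially ordered pointwise, and let $\mathrm{E}(X)$ be the set of minimal elements of $\Delta(X)$, with metric $\|f-g\|_\infty=\sup_{x\in X}|f(x)-g(x)|$ (finite on $\mathrm{E}(X)$). With the embedding $\mathrm{e}(y)=d(\cdot,y)$, this is the injective hull of $X$. $X$ is discretely geodesic if $d$ is integer valued and for all $x,y\in X$ there is an isometric embedding $\gamma\colon\{0,1,\dots,d(x,y)\}\to X$ with $\gamma(0)=x$, $\gamma(d(x,y))=y$. The interval is $I(x,y)=\{v : d(x,v)+d(v,y)=d(x,y)\}$. $X$ has $\beta$-stable intervals if for all $x,y,y'\in X$ with $d(y,y')=1$ the Hausdorff distance between $I(x,y)$ and $I(x,y')$ is at most $\beta$. Polytopes are convex and compact; $l^n_\infty$ is $\mathbb{R}^n$ with the sup norm. *)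

(* Defs.v *)
From Stdlib Require Import Reals List.
From mathcomp Require Import ssreflect ssrfun ssrbool eqtype ssrnat seq fintype bigop.
From Coquelicot Require Import Rbar Lub.

Set Implicit Arguments.
Unset Strict Implicit.

Local Open Scope R_scope.

Definition is_metric (T : Type) (d : T -> T -> R) : Prop :=
  (forall x y, d x y = 0 <-> x = y) /\
  (forall x y, d x y = d y x) /\
  (forall x y z, d x z <= d x y + d y z).

(* sup_{z} |f z - g z| (the 0 is harmless since all terms are >= 0;
   it makes the supremum well defined when T is empty). *)
Definition supd (T : Type) (f g : T -> R) : R :=
  real (Lub_Rbar (fun t => t = 0 \/ exists z, t = Rabs (f z - g z))).

Definition injective_space (T : Type) (Y : T -> Prop) (dist : T -> T -> R) : Prop :=
  forall (B : Type) (dB : B -> B -> R), is_metric dB ->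
  forall (A : B -> Prop) (f : B -> T),
    (forall a, A a -> Y (f a)) ->
    (forall a a', A a -> A a' -> dist (f a) (f a') <= dB a a') ->
    exists g : B -> T,
      (forall b, Y (g b)) /\
      (forall b b', dist (g b) (g b') <= dB b b') /\
      (forall a, A a -> g a = f a).

Definition m_open (T : Type) (Z : T -> Prop) (dist : T -> T -> R) (U : T -> Prop) :=
  (forall f, U f -> Z f) /\
  forall f, U f -> exists eps, 0 < eps /\
    forall g, Z g -> dist f g < eps -> U g.

Definition m_closed (T : Type) (Z : T -> Prop) (dist : T -> T -> R) (S : T -> Prop) :=
  (forall f, S f -> Z f) /\
  forall f, Z f -> ~ S f -> exists eps, 0 < eps /\
    forall g, Z g -> dist f g < eps -> ~ S g.

Definition m_bounded (T : Type) (Z : T -> Prop) (dist : T -> T -> R) (S : T -> Prop) :=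
  exists c r, Z c /\ forall f, S f -> dist c f <= r.

Definition m_compact (T : Type) (Z : T -> Prop) (dist : T -> T -> R) (S : T -> Prop) :=
  (forall f, S f -> Z f) /\
  forall (I : Type) (U : I -> T -> Prop),
    (forall i, m_open Z dist (U i)) ->
    (forall f, S f -> exists i, U i f) ->
    exists l : list I, forall f, S f -> exists i, In i l /\ U i f.

Definition m_proper (T : Type) (Z : T -> Prop) (dist : T -> T -> R) :=
  forall S, (forall f, S f -> Z f) -> m_bounded Z dist S -> m_closed Z dist S ->
    m_compact Z dist S.

Definition isometric (T : Type) (dist : T -> T -> R) (S S' : T -> Prop) :=
  exists h : T -> T,
    (forall f, S f -> S' (h f)) /\
    (forall g, S' g -> exists f, S f /\ h f = g) /\
    (forall f f', S f -> S f' -> dist (h f) (h f') = dist f f').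

Definition Rn (n : nat) := 'I_n -> R.

Definition linf (n : nat) (p q : Rn n) : R := supd p q.

Definition dot (n : nat) (c p : Rn n) : R := \big[Rplus/0]_(i < n) (c i * p i).

Definition conv_hull (n : nat) (L : list (Rn n)) (x : Rn n) : Prop :=
  exists w : nat -> R,
    (forall k, 0 <= w k) /\
    \big[Rplus/0]_(k < size L) w k = 1 /\
    forall i, x i = \big[Rplus/0]_(k < size L) (w k * (nth (fun _ => 0) L k) i).

Definition is_polytope (n : nat) (P : Rn n -> Prop) : Prop :=
  exists L : list (Rn n), forall x, P x <-> conv_hull L x.

Definition full_dim (n : nat) (P : Rn n -> Prop) : Prop :=
  exists c r, 0 < r /\ forall x, linf c x < r -> P x.

Definition is_face (n : nat) (P F : Rn n -> Prop) : Prop :=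
  (forall x, F x <-> P x) \/
  exists (c : Rn n) (b : R),
    (forall p, P p -> dot c p <= b) /\
    (forall x, F x <-> (P x /\ dot c x = b)).

Definition cell (T J : Type) (dim : J -> nat) (poly : forall j, Rn (dim j) -> Prop)
  (chart : forall j, Rn (dim j) -> T) (j : J) (f : T) : Prop :=
  exists p, poly j p /\ chart j p = f.

Definition polyhedral_complex (T : Type) (Z : T -> Prop) (dist : T -> T -> R)
  (J : Type) (dim : J -> nat) (poly : forall j, Rn (dim j) -> Prop)
  (chart : forall j, Rn (dim j) -> T) : Prop :=
  let C := cell poly chart in
  (forall j, is_polytope (poly j) /\ full_dim (poly j) /\
     (forall p, poly j p -> Z (chart j p)) /\
     (forall p q, poly j p -> poly j q -> dist (chart j p) (chart j q) = linf p q)) /\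
  (forall f, Z f -> exists j, C j f) /\
  (forall j F, is_face (poly j) F -> (exists p, F p) ->
     exists k, forall f, C k f <-> exists p, F p /\ chart j p = f) /\
  (forall j k, (exists f, C j f /\ C k f) ->
     exists F, is_face (poly j) F /\
       forall f, (C j f /\ C k f) <-> exists p, F p /\ chart j p = f).

Definition locally_finite (T : Type) (Z : T -> Prop) (dist : T -> T -> R)
  (J : Type) (dim : J -> nat) (poly : forall j, Rn (dim j) -> Prop)
  (chart : forall j, Rn (dim j) -> T) : Prop :=
  forall f, Z f -> exists eps, 0 < eps /\ exists l : list J,
    forall j, (exists g, Z g /\ dist f g < eps /\ cell poly chart j g) ->
      exists k, In k l /\ forall g, cell poly chart j g <-> cell poly chart k g.

Definition dR (X : Type) (d : X -> X -> nat) : X -> X -> R := fun x y => INR (d x y).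

Definition discretely_geodesic (X : Type) (d : X -> X -> nat) : Prop :=
  is_metric (dR d) /\
  forall x y, exists gam : nat -> X,
    gam 0%nat = x /\ gam (d x y) = y /\
    forall i j, (i <= d x y)%nat -> (j <= d x y)%nat ->
      INR (d (gam i) (gam j)) = Rabs (INR i - INR j).

Definition bounded_finite (X : Type) (d : X -> X -> nat) : Prop :=
  forall S : X -> Prop,
    (exists x0 r, forall s, S s -> INR (d x0 s) <= r) ->
    exists l : list X, forall s, S s -> In s l.

Definition interval (X : Type) (d : X -> X -> nat) (x y v : X) : Prop :=
  (d x v + d v y = d x y)%nat.

(* Hausdorff distance between A and B is <= beta, i.e.
   sup_{a in A} inf_{b in B} d(a,b) <= beta and symmetrically. *)
Definition hausdorff_le (X : Type) (d : X -> X -> nat) (A B : X -> Prop) (beta : R) : Prop :=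
  (forall a, A a -> forall eps, 0 < eps -> exists b, B b /\ INR (d a b) < beta + eps) /\
  (forall b, B b -> forall eps, 0 < eps -> exists a, A a /\ INR (d a b) < beta + eps).

Definition stable_intervals (X : Type) (d : X -> X -> nat) (beta : R) : Prop :=
  forall x y y', d y y' = 1%nat ->
    hausdorff_le d (interval d x y) (interval d x y') beta.

Definition Delta (X : Type) (d : X -> X -> nat) (f : X -> R) : Prop :=
  forall x y, f x + f y >= INR (d x y).

Definition EX (X : Type) (d : X -> X -> nat) (f : X -> R) : Prop :=
  Delta d f /\ forall g, Delta d g -> (forall x, g x <= f x) -> g = f.

Definition Edist (X : Type) (f g : X -> R) : R := supd f g.

(* Main.v *)
(* Call a pair (x, y) tight for f in E(X) when f x + f y = d(x, y), and let A(f) be the set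
   of tight pairs. Fix a base function f0 and K. Stability of intervals forces, for all
   tight pairs of the functions f within K of f0, the interval I(x, y) to pass through a
   fixed finite ball, and leaves only finitely many cones {y : v in I(x, y)} for each v.
   So every tight pair carries one of finitely many labels (v, cone of x at v), and
   f x - d(x, v) depends only on f and on the label. This has three consequences:
   - the values of f lie in finitely many cosets of Z, whence suprema are attained and
     the positive values of f x + f y - d(x, y) are bounded below;
   - on the cell {h : A(g) included in A(h)}, the functions h |-> h x - g x are, up to sign,
     finitely many; choosing representatives gives the coordinates of the chart;
   - only finitely many half-integral functions of E(X) lie within K of f0.
   Rounding f by a monotone odd Z-equivariant map R -> (1/2)Z stays in every cell containing f,
   and f is an average of its roundings. So a cell is the convex hull of its
   half-integral points, and A(f) is the intersection of the sets A(h) over the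
   half-integral h in its cell; this gives local finiteness. Geodesics bound the diameter
   of an n-dimensional cell in terms of n, which leaves finitely many polytopes. *)

Require Import Defs.
From Stdlib Require Import Reals List.

(* The module confines the MathComp notations: in the theorem, [<=] on [nat] is Peano's. *)
Module Hull.

From Stdlib Require Import ZArith Lra Lia Classical ClassicalEpsilon FunctionalExtensionality.
From HB Require Import structures.
From mathcomp Require Import ssreflect ssrfun ssrbool eqtype ssrnat seq path fintype bigop.
From Coquelicot Require Import Rbar Lub Compactness.

Set Implicit Arguments.
Unset Strict Implicit.
Local Open Scope R_scope.

(* The standard library shadows [Delta]. *)
Local Notation Delta := Defs.Delta.

(** * Finiteness *)

Lemma Rabs_le_inv (x a : R) : Rabs x <= a -> - a <= x <= a.
Proof. by rewrite /Rabs; case: Rcase_abs; lra. Qed.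

(** The labels are treated one at a time, each contributing at most one representative. An element
    may carry several labels; it is enough that it shares one with a representative, and the
    representatives themselves satisfy [Q]. *)
Lemma finite_reps (U V : Type) (Q : U -> Prop) (T : U -> V -> Prop) (lv : list V) :
  (forall u, Q u -> exists v, In v lv /\ T u v) ->
  exists lu : list U, (forall u, In u lu -> Q u) /\
    forall u, Q u -> exists u' v, In u' lu /\ In v lv /\ T u v /\ T u' v.
Proof.
elim: lv Q => [|v lv IH] Q H.
  by exists nil; split=> // u /H [v []].
have [lu [lu1 lu2]] : exists lu : list U,
    (forall u, In u lu -> Q u /\ ~ T u v) /\
    forall u, Q u /\ ~ T u v -> exists u' w, In u' lu /\ In w lv /\ T u w /\ T u' w.
  apply: (IH (fun u => Q u /\ ~ T u v)) => u [Qu nT].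
  have [w [[<-|wlv] Tw]] := H _ Qu; first by [].
  by exists w.
have [[u0 [Q0 T0]]|no] := classic (exists u, Q u /\ T u v).
  exists (u0 :: lu); split=> [u /= [<-//|/lu1 []//]|u Qu].
  have [Tu|nTu] := classic (T u v).
    by exists u0, v; do !split=> //; left.
  have [u' [w [h1 [h2 h3]]]] := lu2 u (conj Qu nTu).
  by exists u', w; do !split=> //; try (by right); apply h3.
exists lu; split=> [u /lu1 []//|u Qu].
have [|u' [w [h1 [h2 h3]]]] := lu2 u; first by split=> // Tu; apply: no; exists u.
by exists u', w; do !split=> //; try (by right); apply h3.
Qed.

(** If every label failed at some tolerance, by monotonicity all would fail at the smallest of
    these. This yields one label valid for arbitrarily small slack. *)
Lemma uniform_choice (V : Type) (P : V -> R -> Prop) (lv : list V) :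
  (forall v e e', P v e -> e <= e' -> P v e') ->
  (forall e, 0 < e -> exists v, In v lv /\ P v e) ->
  exists v, In v lv /\ forall e, 0 < e -> P v e.
Proof.
move=> mono; elim: lv => [|v lv IH] H.
  by have [] := H 1 Rlt_0_1 => ? [].
have [all|nall] := classic (forall e, 0 < e -> P v e).
  by exists v; split=> //; left.
have [e0 ne0] := not_all_ex_not _ _ nall.
have [e0p nP] := imply_to_and _ _ ne0.
have [|w [wl wP]] := IH; last by exists w; split=> //; right.
move=> e ep.
have [w [[<-|wl] Pw]] := H (Rmin e e0) (Rmin_glb_lt _ _ _ ep e0p).
  by case: nP; apply: mono Pw (Rmin_r _ _).
by exists w; split=> //; apply: mono Pw (Rmin_l _ _).
Qed.

Lemma INR_bounded (r : R) : exists n : nat, r <= INR n.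
Proof.
have [n] := INR_unbounded r; by exists n; apply: Rlt_le.
Qed.

Lemma floor_nat (r : R) : 0 <= r -> exists k : nat, INR k <= r < INR k + 1.
Proof.
move=> r0; have [h1 h2] := base_Int_part r.
have h0 : (-1 < Int_part r)%Z by apply: lt_IZR; lra.
have h : (0 <= Int_part r)%Z by lia.
exists (Z.to_nat (Int_part r)).
rewrite INR_IZR_INZ Z2Nat.id //; lra.
Qed.

Lemma totally_bounded (U I : Type) (Q : U -> Prop) (li : list I) (m : I -> U -> R) (K delta : R) :
  0 < delta ->
  (forall u i, Q u -> In i li -> Rabs (m i u) <= K) ->
  exists lu : list U, (forall u, In u lu -> Q u) /\
    forall u, Q u -> exists u', In u' lu /\ forall i, In i li -> Rabs (m i u - m i u') < delta.
Proof.
elim: li delta => [|i li IH] delta dpos H.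
  have [|lu [h1 h2]] := @finite_reps U unit Q (fun _ _ => True) (tt :: nil).
    by move=> u _; exists tt; split=> //; left.
  exists lu; split=> // u /h2 [u' [_ [hu' _]]].
  by exists u'.
have [|u j Qu jl|lu [h1 h2]] := IH (delta / 2); first lra.
  by apply: H => //; right.
have [N HN] := INR_bounded (2 * K / delta).
(* The label pairs a net point for the earlier measurements with the index of the grid interval of
   width [delta] containing the new one. Sharing a label costs twice [delta / 2] on the earlier
   measurements. *)
have [|lw [w1 w2]] := @finite_reps U (U * nat) Q
  (fun u p => (forall j, In j li -> Rabs (m j u - m j p.1) < delta / 2) /\
     INR p.2 <= (m i u + K) / delta < INR p.2 + 1) (list_prod lu (List.seq 0 N.+1)).
  move=> u Qu; have [u' [hu' hj]] := h2 u Qu.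
  have Ki : Rabs (m i u) <= K by apply: H => //; left.
  have [h3 h4] := Rabs_le_inv Ki.
  have [|k hk] := @floor_nat ((m i u + K) / delta).
    by apply: Rmult_le_pos; [lra|apply: Rlt_le; apply: Rinv_0_lt_compat].
  exists (u', k); split=> //; apply: in_prod => //; apply/in_seq.
  have : (m i u + K) / delta <= 2 * K / delta.
    apply: Rmult_le_compat_r; last lra.
    by apply: Rlt_le; apply: Rinv_0_lt_compat.
  move=> h5; have : INR k <= INR N by lra.
  by move/INR_le; lia.
exists lw; split=> // u /w2 [u' [[u0 k] [hu' [_ [[/= a1 a2] [/= b1 b2]]]]]].
exists u'; split=> // j [<-|jl]; last first.
  have := a1 _ jl; have := b1 _ jl; rewrite /Rabs; do !case: Rcase_abs; lra.
set s := (m i u + K) / delta in a2; set s' := (m i u' + K) / delta in b2.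
have -> : m i u - m i u' = delta * (s - s') by rewrite /s /s'; field; lra.
rewrite Rabs_mult (Rabs_pos_eq delta); last lra.
have : Rabs (s - s') < 1 by rewrite /Rabs; case: Rcase_abs; lra.
by move=> h; rewrite -{2}(Rmult_1_r delta); apply: Rmult_lt_compat_l.
Qed.

(* [m + up (- m)] is the least positive element of the coset [m + Z]. *)
Lemma discrete_gap (lm : list R) :
  exists eta, 0 < eta /\ forall m k, In m lm -> 0 < m + IZR k -> eta <= m + IZR k.
Proof.
elim: lm => [|m lm [eta [e0 He]]]; first by exists 1; split=> //; lra.
have [h1 h2] := archimed (- m).
exists (Rmin eta (m + IZR (up (- m)))); split.
  by apply: Rmin_glb_lt; lra.
move=> m' k [<-|ml] pos; last by apply: Rle_trans (Rmin_l _ _) (He _ _ ml pos).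
apply: Rle_trans (Rmin_r _ _) _.
have : (up (- m) - 1 < k)%Z by apply: lt_IZR; rewrite minus_IZR; lra.
move=> h; have : IZR (up (- m)) <= IZR k by apply: IZR_le; lia.
lra.
Qed.


(** * Cones and labels *)

Lemma INR_lt_succ (m n : nat) : INR m < INR n + 1 -> INR m <= INR n.
Proof. rewrite -S_INR => /INR_lt h; apply: le_INR; lia. Qed.

Section Space.

Variables (X : Type) (d : X -> X -> nat).
Notation D x y := (INR (d x y)).
Hypothesis geo : discretely_geodesic d.

Lemma D_refl (x : X) : D x x = 0.
Proof. by have [[h _] _] := geo; apply/h. Qed.

Lemma D_sym (x y : X) : D x y = D y x.
Proof. by have [[_ [h _]] _] := geo; apply: h. Qed.

Lemma D_tri (x y z : X) : D x z <= D x y + D y z.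
Proof. by have [[_ [_ h]] _] := geo; apply: h. Qed.

Lemma D_eq0 (x y : X) : D x y = 0 -> x = y.
Proof. by have [[h _] _] := geo; move/h. Qed.

Lemma geodesic_step (x y : X) (n : nat) :
  d x y = S n -> exists z, D x z = 1 /\ d z y = n.
Proof.
move=> e; have [_ g] := geo; have [gam [g0 [g1 H]]] := g x y.
rewrite e in g1 H; exists (gam 1%nat); split.
  by rewrite -g0 H // INR_1 Rabs_left /=; lra.
apply: INR_eq; rewrite -g1 H // (S_INR n) INR_1 Rabs_left1; have := pos_INR n; lra.
Qed.

Section Stable.

Hypothesis bf : bounded_finite d.
Variable b : nat.
Hypothesis stable : forall x y y' v, D y y' = 1 -> D x v + D v y = D x y ->
  exists v', D x v' + D v' y' = D x y' /\ D v v' <= INR b.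

(* Walking from [z] to [y], the excess [d x z + d z y - d x y] never increases; the
   interval from [x] grows along the steps that preserve it and [b]-moves along
   the at most [k] others. *)
Lemma interval_passes_near (n k : nat) (x y z w : X) :
  d z y = n -> D x w + D w z = D x z -> D x z + D z y <= D x y + INR k ->
  exists v, D x v + D v y = D x y /\ D w v <= INR k * INR b.
Proof.
elim: n k z w => [|n IH] k z w.
  move=> h0 h1 h2; have zy : z = y by apply: D_eq0; rewrite h0.
  subst z; exists w; split=> //; rewrite D_refl.
  by apply: Rmult_le_pos; apply: pos_INR.
move=> h0 h1 h2; have [z' [zz' z'y]] := geodesic_step h0.
have := D_tri x z z'; rewrite zz' => t1.
have := D_tri x z' y; rewrite z'y => t2.
rewrite h0 S_INR in h2.
have [e|ne] := Req_dec (D x z') (D x z + 1).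
  have t3 := D_tri w z z'; have t4 := D_tri x w z'.
  apply: (IH k z' w) => //; first lra.
  rewrite z'y; lra.
have le : D x z' <= D x z by apply: INR_lt_succ; lra.
have k1 : 1 <= INR k by lra.
case: k k1 h2 => [|k _ h2]; first by rewrite [INR 0]/=; lra.
rewrite S_INR in h2 *.
have [w' [hw' ww']] := stable zz' h1.
have [|v [hv w'v]] := IH k z' w' z'y hw'; first by rewrite z'y; lra.
exists v; split=> //; have := D_tri w w' v; lra.
Qed.

Definition same_cone (v x x' : X) :=
  forall y, D x v + D v y = D x y <-> D x' v + D v y = D x' y.

(** Induction along a geodesic from [v] to [y]. If the last step left the cone of [x'], stability
    would give a point [v'] of the [b]-ball about [v] in the interval from [x'] to [y]; since [x]
    and [x'] have the same relative distances on that ball, the route through [v'] would make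
    [D x y] too short. *)
Lemma cone_incl (v x x' : X) :
  (forall w, D v w <= INR b -> D x w - D x v = D x' w - D x' v) ->
  forall y, D x v + D v y = D x y -> D x' v + D v y = D x' y.
Proof.
move=> H y; move: {2}(d v y) (erefl (d v y)) => n.
elim: n y => [|n IH] y hn hy.
  by have <- : v = y; [apply: D_eq0; rewrite hn|rewrite D_refl Rplus_0_r].
have [|z [yz zv]] := @geodesic_step y v n.
  by apply: INR_eq; rewrite D_sym hn.
have vz : D v z = INR n by rewrite D_sym zv.
have zy : D z y = 1 by rewrite D_sym.
rewrite hn S_INR in hy *.
have t1 := D_tri x z y; have t2 := D_tri x v z; have t3 := D_tri x' z y; have t4 := D_tri x' v z.
have hz : D x' v + D v z = D x' z by apply: IH; [apply: INR_eq|lra].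
apply: Rle_antisym; last lra.
apply: Rnot_lt_le => lt.
have le : D x' y <= D x' z by apply: INR_lt_succ; lra.
have [v' [hv' vv']] := stable zy hz.
have := H v' vv'; have := D_tri x v' y; lra.
Qed.

(** By [cone_incl] the cone depends only on the function [D x w - D x v] on the [b]-ball about [v].
    It is integer valued and bounded by [b], so a net of mesh 1/2 separates all cases. *)
Lemma finitely_many_cones (v : X) : exists lx : list X, forall x,
  exists x', In x' lx /\ same_cone v x x'.
Proof.
have [|lw Hlw] := @bf (fun w => D v w <= INR b).
  by exists v, (INR b).
(* [bf] only provides a list containing the ball, and the bound [INR b] holds on the ball alone. *)
have [lw' Hlw'] : exists lw' : list X, forall w, In w lw' <-> D v w <= INR b.
  have [|lw' [h1 h2]] := @finite_reps X X (fun w => D v w <= INR b) eq lw.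
    by move=> u /Hlw; exists u.
  by exists lw' => w; split=> [/h1 //|/h2 [u' [v0 [hu [_ [-> <-]]]]]].
have [||lx [_ Hx]] := @totally_bounded X X (fun _ => True) lw'
    (fun w x => D x w - D x v) (INR b) (1 / 2); first lra.
  move=> x w _ /Hlw' vw; have := D_tri x v w; have := D_tri x w v.
  by rewrite (D_sym w v) => h1 h2; apply: Rabs_le; lra.
exists lx => x; have [//|x' [h1 h2]] := Hx x; exists x'; split=> //.
have H w : D v w <= INR b -> D x w - D x v = D x' w - D x' v.
  move/Hlw'/h2; rewrite !INR_IZR_INZ -!minus_IZR => h; congr IZR.
  have [h3 h4] := Rabs_def2 _ _ h.
  have : (Z.of_nat (d x w) - Z.of_nat (d x v) - (Z.of_nat (d x' w) - Z.of_nat (d x' v)) < 1)%Z.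
    by apply: lt_IZR; rewrite !minus_IZR in h3 h4 *; lra.
  have : (- 1 < Z.of_nat (d x w) - Z.of_nat (d x v) - (Z.of_nat (d x' w) - Z.of_nat (d x' v)))%Z.
    by apply: lt_IZR; rewrite !minus_IZR in h3 h4 *; lra.
  lia.
move=> y; split; apply: cone_incl => // w /H; lra.
Qed.

(** For a fixed [z], the excess of the route from [x] to [y] through [z] is at most [2 * f z + 1],
    hence at most [k]. The slack 1 admits almost tight pairs, because tight partners are only
    obtained later. *)
Lemma finite_labels (f0 : X -> R) (K : R) : exists L : list (X * X),
  forall f, Delta d f -> (forall x y, f x <= f y + D x y) ->
  (forall x, Rabs (f x - f0 x) <= K) ->
  forall x y, f x + f y <= D x y + 1 ->
  exists v w, In (v, w) L /\ D x v + D v y = D x y /\ same_cone v x w.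
Proof.
have [[z _]|nz] := classic (exists z : X, True); last first.
  by exists nil => f _ _ _ x; case: nz; exists x.
have [k Hk] := INR_bounded (2 * (f0 z + K) + 1).
have [|lv Hlv] := @bf (fun v => D z v <= INR k * INR b); first by exists z, (INR k * INR b).
have [L HL] : exists L : list (X * X), forall v, In v lv -> forall x,
    exists w, In (v, w) L /\ same_cone v x w.
  elim: {Hlv} lv => [|v lv [L HL]]; first by exists nil.
  have [lx Hx] := finitely_many_cones v.
  exists (map (pair v) lx ++ L)%list => v' /= [<-|hv'] x.
    have [x' [h1 h2]] := Hx x; exists x'; split=> //.
    by apply: in_or_app; left; apply: in_map.
  have [w [h1 h2]] := HL _ hv' x; exists w; split=> //.
  by apply: in_or_app; right.
exists L => f fD flip fK x y fxy.
have := fK z; move/Rabs_le_inv => [_ fz].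
have [v [hv zv]] : exists v, D x v + D v y = D x y /\ D z v <= INR k * INR b.
  apply: (@interval_passes_near (d z y) k x y z z) => //.
    by rewrite D_refl; lra.
  have := fD x z; have := fD z y; lra.
have [w [h1 h2]] := HL _ (Hlv _ zv) x.
by exists v, w.
Qed.

End Stable.
End Space.

(** * The injective hull *)

(** The form in which stable intervals and the finiteness of bounded sets enter all later
    arguments. *)
Definition same_cone_labels (X : Type) (d : X -> X -> nat) := forall (f0 : X -> R) (K : R),
  exists L : list (X * X),
  forall f, Delta d f -> (forall x y, f x <= f y + INR (d x y)) ->
  (forall x, Rabs (f x - f0 x) <= K) ->
  forall x y, f x + f y <= INR (d x y) + 1 ->
  exists v w, In (v, w) L /\ INR (d x v) + INR (d v y) = INR (d x y) /\ same_cone d v x w.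

Lemma stable_same_cone_labels (X : Type) (d : X -> X -> nat) (beta : R) :
  discretely_geodesic d -> bounded_finite d -> stable_intervals d beta ->
  same_cone_labels d.
Proof.
(* The Hausdorff bound is used with [eps = 1], whence a natural number above [beta + 1]. *)
move=> geo bf st f0 K; have [b hb] := INR_bounded (beta + 1).
apply: (@finite_labels X d geo bf b) => x y y' v hyy' hv.
have [|h _] := st x y y'; first by apply: INR_eq; rewrite hyy'.
have [|v' [hv' vv']] := h v _ 1 Rlt_0_1.
  by apply: INR_eq; rewrite plus_INR.
exists v'; split; last by lra.
by rewrite -hv' plus_INR.
Qed.

Section Space.

Variables (X : Type) (d : X -> X -> nat).
Notation D x y := (INR (d x y)).
Hypothesis geo : discretely_geodesic d.
Let D_refl := D_refl geo.
Let D_sym := D_sym geo.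
Let D_tri := D_tri geo.

Lemma Delta_ge0 (f : X -> R) (x : X) : Delta d f -> 0 <= f x.
Proof. by move=> /(_ x x); rewrite D_refl; lra. Qed.

(** If every partner of [x] left slack at least [e], lowering [f] by [e / 2] at [x] alone would stay
    in [Delta]; the pair of [x] with itself consumes the whole slack. *)
Lemma EX_near (f : X -> R) (x : X) (e : R) :
  EX d f -> 0 < e -> exists y, f x + f y < D x y + e.
Proof.
move=> [fD fmin] e0; apply: NNPP => no.
have H y : D x y + e <= f x + f y by apply: Rnot_lt_le => h; apply: no; exists y.
pose g y := if excluded_middle_informative (y = x) then f x - e / 2 else f y.
have gD : Delta d g.
  move=> y z; rewrite /g; case: excluded_middle_informative => [yx|_] /=;
    case: excluded_middle_informative => [zx|_] /=; rewrite ?yx ?zx.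
  - by have := H x; rewrite D_refl; lra.
  - by have := H z; lra.
  - by have := H y; rewrite (D_sym y x); lra.
  - exact: fD.
have gf : g = f.
  apply: fmin gD _ => y; rewrite /g; case: excluded_middle_informative => [yx|_] /=; rewrite ?yx; lra.
have := f_equal (fun h => h x) gf; rewrite /g /=.
by case: excluded_middle_informative => // _ /= h; lra.
Qed.

Lemma EX_lip (f : X -> R) : EX d f -> forall x y, f x <= f y + D x y.
Proof.
move=> fE x y; apply: le_epsilon => e e0.
have [z hz] := EX_near x fE e0; have := fE.1 y z; have := D_tri x y z; lra.
Qed.

Lemma EX_intro (f : X -> R) :
  Delta d f -> (forall x, exists y, f x + f y = D x y) -> EX d f.
Proof.
move=> fD H; split=> // g gD gf; apply: functional_extensionality => x.
have [y hy] := H x; have := gD x y; have := gf x; have := gf y; lra.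
Qed.

Lemma EX_bounded (f g : X -> R) :
  EX d f -> EX d g -> exists M, 0 <= M /\ forall x, Rabs (f x - g x) <= M.
Proof.
move=> fE gE; have [[z _]|nz] := classic (exists z : X, True); last first.
  by exists 0; split=> [|x]; [lra|case: nz; exists x].
exists (f z + g z); split.
  by have := Delta_ge0 z fE.1; have := Delta_ge0 z gE.1; lra.
move=> x; apply: Rabs_le.
have := EX_lip fE x z; have := EX_lip gE x z; have := fE.1 x z; have := gE.1 x z; lra.
Qed.

(** [f] ranges over the cell of [g]. Its minimality comes from the tight partners inherited from
    [g]. *)
Definition in_cell (g f : X -> R) :=
  Delta d f /\ forall x y, g x + g y = D x y -> f x + f y = D x y.

(** The point [y] lies also in the cone of [x'] at [v], so [f x' + f y] is at least
    [D x' v + D v y]; the almost tight pair at [x] bounds [f y] from above. *)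
Lemma same_label_eq (f : X -> R) (v w x y x' y' : X) : Delta d f ->
  D x v + D v y = D x y -> D x' v + D v y' = D x' y' ->
  same_cone d v x w -> same_cone d v x' w ->
  forall e, f x + f y <= D x y + e -> f x - D x v <= f x' - D x' v + e.
Proof.
move=> fD h h' c c' e fxy.
have /c/c' hx' := h; have := fD x' y; lra.
Qed.

Section Labels.

Hypothesis lab : same_cone_labels d.

Lemma EX_labels (f0 : X -> R) (K : R) : exists L : list (X * X),
  forall f, EX d f -> (forall x, Rabs (f x - f0 x) <= K) ->
  forall x y, f x + f y <= INR (d x y) + 1 ->
  exists v w, In (v, w) L /\ D x v + D v y = D x y /\ same_cone d v x w.
Proof.
have [L HL] := lab f0 K; exists L => f fE; apply: HL; [exact: fE.1|exact: EX_lip].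
Qed.

(** Two points with a common label differ in value by a difference of distances, an integer.
    Attainment of the suprema is not yet known, so the label of a point is chosen to serve almost
    tight partners of every slack. *)
Lemma EX_values (f : X -> R) : EX d f ->
  exists l : list X, forall x, exists x' k, In x' l /\ f x = f x' + IZR k.
Proof.
move=> fE; have [L HL] := EX_labels f 0.
have f00 x : Rabs (f x - f x) <= 0 by rewrite Rminus_diag Rabs_R0; lra.
have {}HL := HL f fE f00.
pose T x (p : X * X) := forall e, 0 < e -> exists y,
  D x p.1 + D p.1 y = D x y /\ same_cone d p.1 x p.2 /\ f x + f y <= D x y + e.
have [x _|l [_ Hl]] := @finite_reps X (X * X) (fun _ => True) T L.
  apply: (@uniform_choice _ (fun p e => exists y,
      D x p.1 + D p.1 y = D x y /\ same_cone d p.1 x p.2 /\ f x + f y <= D x y + e)).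
    by move=> p e e' [y [h1 [h2 h3]]] ee'; exists y; do 2?split=> //; lra.
  move=> e e0; have [|y hy] := @EX_near f x (Rmin e 1) fE; first by apply: Rmin_glb_lt; lra.
  have := Rmin_l e 1; have := Rmin_r e 1 => h1 h2.
  have [|v [w [h3 [h4 h5]]]] := HL x y; first lra.
  by exists (v, w); split=> //; exists y; do 2?split=> //; lra.
exists l => x; have [//|x' [[v w] [hx' [_ [Tx Tx']]]]] := Hl x.
exists x', (Z.of_nat (d x v) - Z.of_nat (d x' v))%Z; split=> //.
rewrite minus_IZR -!INR_IZR_INZ.
suff : f x - D x v = f x' - D x' v by lra.
apply: Rle_antisym; apply: le_epsilon => e e0;
  have [y /= [h1 [h2 h3]]] := Tx _ e0; have [y' /= [h1' [h2' h3']]] := Tx' _ e0.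
- by apply: (@same_label_eq f v w x y x' y') => //; exact: fE.1.
- by apply: (@same_label_eq f v w x' y' x y) => //; exact: fE.1.
Qed.

(** The excesses [f x + f y - D x y] lie in finitely many cosets of the integers. *)
Lemma EX_gap (f : X -> R) : EX d f ->
  exists eta, 0 < eta /\ forall x y, D x y < f x + f y -> D x y + eta <= f x + f y.
Proof.
move=> fE; have [l Hl] := EX_values fE.
have [eta [e0 He]] := discrete_gap (map (fun p => f p.1 + f p.2) (list_prod l l)).
exists eta; split=> // x y.
have [x' [k [hx' ->]]] := Hl x; have [y' [k' [hy' ->]]] := Hl y => h.
have hin : In (f x' + f y') (map (fun p => f p.1 + f p.2) (list_prod l l)).
  by apply: (in_map (fun p => f p.1 + f p.2) _ (x', y')); apply: in_prod.
have {}He := He _ (k + k' - Z.of_nat (d x y))%Z hin.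
rewrite minus_IZR plus_IZR -INR_IZR_INZ in He.
have := He ltac:(lra); lra.
Qed.

Lemma EX_tight (f : X -> R) : EX d f -> forall x, exists y, f x + f y = D x y.
Proof.
move=> fE x; have [eta [e0 He]] := EX_gap fE.
have [y hy] := EX_near x fE e0; exists y.
by apply: NNPP => ne; have := fE.1 x y; have := He x y; lra.
Qed.

Lemma in_cell_EX (g f : X -> R) : EX d g -> in_cell g f -> EX d f.
Proof.
move=> gE [fD H]; apply: EX_intro => // x.
by have [y /H hy] := EX_tight gE x; exists y.
Qed.

Lemma in_cell_refl (g : X -> R) : EX d g -> in_cell g g.
Proof. by case. Qed.

(** Tight pairs of [g] stay tight for every [f] in the cell, so points with a common label satisfy
    [f x - D x v = f x' - D x' v] for [f] and for [g]; subtracting removes the distances. *)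
Lemma cell_types (g : X -> R) : EX d g ->
  exists l : list X, forall x, exists x', In x' l /\
    forall f, in_cell g f -> f x - g x = f x' - g x'.
Proof.
move=> gE; have [L HL] := EX_labels g 0.
have g00 x : Rabs (g x - g x) <= 0 by rewrite Rminus_diag Rabs_R0; lra.
have {}HL := HL g gE g00.
pose T x (p : X * X) := exists y,
  D x p.1 + D p.1 y = D x y /\ same_cone d p.1 x p.2 /\ g x + g y = D x y.
have [x _|l [_ Hl]] := @finite_reps X (X * X) (fun _ => True) T L.
  have [y hy] := EX_tight gE x.
  have [|v [w [h1 [h2 h3]]]] := HL x y; first lra.
  by exists (v, w); split=> //; exists y; do 2?split=> //.
exists l => x.
have [//|x' [[v w] [hx' [_ [[y /= [h1 [h2 h3]]] [y' /= [h1' [h2' h3']]]]]]]] := Hl x.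
exists x'; split=> // f fC.
have H h : in_cell g h -> h x - D x v = h x' - D x' v.
  move=> [hD hH]; have h4 := hH _ _ h3; have h4' := hH _ _ h3'.
  have h5 := @same_label_eq h v w x y x' y' hD h1 h1' h2 h2' 0.
  have h5' := @same_label_eq h v w x' y' x y hD h1' h1 h2' h2 0.
  lra.
have := H _ fC; have := H _ (in_cell_refl gE); lra.
Qed.

End Labels.

End Space.

(** * Half-integral functions *)

(* For every offset [s], the rounding map is monotone, odd and commutes with integer
   translations; these are the properties that preserve all inequalities
   [f x + f y >= n] with [n] an integer, and the equality cases. *)
Definition rounding (s r : R) : R := (IZR (Int_part (r + s)) - IZR (Int_part (s - r))) / 2.

Lemma Int_part_shift (r : R) (k : Z) : Int_part (r + IZR k) = (Int_part r + k)%Z.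
Proof.
symmetry; apply: Int_part_spec; rewrite plus_IZR.
have := base_Int_part r; lra.
Qed.

Lemma Int_part_mono (r r' : R) : r <= r' -> IZR (Int_part r) <= IZR (Int_part r').
Proof.
move=> h; apply: IZR_le; have := base_Int_part r; have := base_Int_part r' => h1 h2.
have : (Int_part r < Int_part r' + 1)%Z by apply: lt_IZR; rewrite plus_IZR; lra.
lia.
Qed.

Definition half_integer (r : R) := exists k : Z, 2 * r = IZR k.

Lemma rounding_half (s r : R) : half_integer (rounding s r).
Proof.
exists (Int_part (r + s) - Int_part (s - r))%Z; rewrite minus_IZR /rounding; lra.
Qed.

Lemma rounding_reflect (s r : R) (n : nat) : rounding s (INR n - r) = INR n - rounding s r.
Proof.
rewrite /rounding.
have -> : INR n - r + s = (s - r) + IZR (Z.of_nat n) by rewrite -INR_IZR_INZ; lra.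
have -> : s - (INR n - r) = (r + s) + IZR (- Z.of_nat n) by rewrite opp_IZR -INR_IZR_INZ; lra.
rewrite !Int_part_shift !(plus_IZR (Int_part _)) opp_IZR -INR_IZR_INZ; lra.
Qed.

Lemma rounding_mono (s r r' : R) : r <= r' -> rounding s r <= rounding s r'.
Proof.
move=> h; rewrite /rounding.
have := @Int_part_mono (r + s) (r' + s); have := @Int_part_mono (s - r') (s - r); lra.
Qed.

Lemma rounding_close (s r : R) : Rabs (rounding s r - r) <= 1 / 2.
Proof.
apply: Rabs_le; rewrite /rounding.
have := base_Int_part (r + s); have := base_Int_part (s - r); lra.
Qed.

(** The offset [- r] places a jump of the rounding map exactly at [r]. *)
Lemma rounding_sep (r r' : R) : r' < r -> rounding (- r) r' < rounding (- r) r.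
Proof.
move=> h; rewrite /rounding.
have h1 := @Int_part_mono (- r - r) (- r - r').
have -> : r + - r = 0 by lra.
have : IZR (Int_part (r' + - r)) < IZR (Int_part 0).
  have := base_Int_part (r' + - r); have <- : 0%Z = Int_part 0; last lra.
  by apply: Int_part_spec; lra.
lra.
Qed.

Lemma half_integer_close (a b : R) :
  half_integer a -> half_integer b -> Rabs (a - b) < 1 / 2 -> a = b.
Proof.
move=> [k hk] [k' hk'] h; have [h1 h2] := Rabs_def2 _ _ h.
have : (k - k' < 1)%Z by apply: lt_IZR; rewrite minus_IZR; lra.
have : (- 1 < k - k')%Z by apply: lt_IZR; rewrite minus_IZR; lra.
move=> h3 h4; have e : k = k' by lia.
by rewrite e in hk; lra.
Qed.

Lemma sublists (A : Type) (l : list A) : exists ll : list (list A),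
  forall P : A -> Prop, exists l', In l' ll /\ forall a, In a l' <-> In a l /\ P a.
Proof.
elim: l => [|a l [ll H]].
  by exists (nil :: nil) => P; exists nil; split; [left|move=> a; split=> // -[]].
exists (ll ++ map (cons a) ll)%list => P; have [l' [h1 h2]] := H P.
have [Pa|nPa] := classic (P a).
  exists (a :: l'); split; first by apply: in_or_app; right; apply: in_map.
  move=> x /=; split=> [[<-|/h2 [h3 h4]]|[[->|h3] h4]].
  - by split=> //; left.
  - by split=> //; right.
  - by left.
  - by right; apply/h2.
exists l'; split; first by apply: in_or_app; left.
move=> x; split=> [/h2 [h3 h4]|[/= [e|h3] h4]]; first by split=> //; right.
  by case: nPa; rewrite e.
by apply/h2.
Qed.

Lemma Glb_Rbar_attained (S : R -> Prop) (t : R) :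
  S t -> (forall u, S u -> t <= u) -> real (Glb_Rbar S) = t.
Proof. by move=> St H; rewrite (is_glb_Rbar_unique S t) //; split=> [u /H|u /(_ _ St)]. Qed.

Lemma Glb_real (S : R -> Prop) (t c : R) : S t -> (forall u, S u -> c <= u) ->
  (forall u, S u -> real (Glb_Rbar S) <= u) /\
  (forall z, (forall u, S u -> z <= u) -> z <= real (Glb_Rbar S)).
Proof.
move=> St H; have [h1 h2] := Glb_Rbar_correct S.
have h3 := h1 _ St; have h4 := h2 (Finite c) H.
move: h1 h2 h3 h4; case: (Glb_Rbar S) => //= r h1 h2 _ _; split=> // z hz.
exact: (h2 (Finite z)).
Qed.

Lemma Glb_Rbar_le (S : R -> Prop) (t c : R) :
  S t -> (forall u, S u -> c <= u) -> c <= real (Glb_Rbar S) <= t.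
Proof. by move=> St H; have [h1 h2] := Glb_real St H; split; [exact: h2|exact: h1]. Qed.

Section Space.

Variables (X : Type) (d : X -> X -> nat).
Notation D x y := (INR (d x y)).
Hypothesis geo : discretely_geodesic d.
Hypothesis lab : same_cone_labels d.

Lemma rounding_in_cell (s : R) (f : X -> R) :
  Delta d f -> in_cell d f (fun x => rounding s (f x)).
Proof.
move=> fD; split=> [x y|x y h].
  have := fD x y => h; have := rounding_reflect s (f y) (d x y).
  have := @rounding_mono s (D x y - f y) (f x); lra.
have := rounding_reflect s (f y) (d x y).
have -> : D x y - f y = f x by lra.
lra.
Qed.

(** For a label [(v, w)], [m] is the infimum of [h x - D x v] over the points [x] with the cone of
    [w]. By tightness each [x] attains it for some label in [L], so finitely many bounded numbers
    determine [h] up to less than 1/2, hence exactly. *)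
Lemma finite_half_integral (f0 : X -> R) (K : R) : exists lh : list (X -> R),
  forall h, EX d h -> (forall x, half_integer (h x)) ->
  (forall x, Rabs (h x - f0 x) <= K) -> In h lh.
Proof.
have [L HL] := EX_labels geo lab f0 K.
pose m (p : X * X) (h : X -> R) :=
  real (Glb_Rbar (fun t => exists x, same_cone d p.1 x p.2 /\ t = h x - D x p.1)).
pose Q h := EX d h /\ (forall x, half_integer (h x)) /\ (forall x, Rabs (h x - f0 x) <= K).
have lowb h p : Q h -> forall t, (exists x, same_cone d p.1 x p.2 /\ t = h x - D x p.1) ->
    - h p.1 <= t.
  by move=> [hE _] t [x [_ ->]]; have := hE.1 x p.1; lra.
have [M HM] : exists M, forall p, In p L -> Rabs (f0 p.1) <= M.
  elim: {HL} L => [|p L [M HM]]; first by exists 0.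
  exists (Rmax M (Rabs (f0 p.1))) => q /= [<-|/HM]; first exact: Rmax_r.
  by move=> h; apply: Rle_trans h (Rmax_l _ _).
have bound h p : Q h -> In p L -> Rabs (m p h) <= M + K.
  move=> Qh pL.
  have [hE [_ hK]] := Qh; have /Rabs_le_inv h1 := HM _ pL; have /Rabs_le_inv h2 := hK p.1.
  have h3 := Delta_ge0 geo p.1 hE.1.
  have [[x hx]|nx] := classic (exists x, same_cone d p.1 x p.2).
    have [|h4 h5] := @Glb_Rbar_le _ (h x - D x p.1) (- h p.1) _ (lowb h p Qh); first by exists x.
    have h6 := EX_lip geo hE x p.1.
    by apply: Rabs_le; rewrite /m; lra.
  (* The infimum over an empty class is [p_infty], which [real] sends to 0. *)
  rewrite /m (_ : Glb_Rbar _ = p_infty); first by rewrite /= Rabs_R0; lra.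
  apply: is_glb_Rbar_unique; split=> [t [x [hx _]]|]; last by case.
  by case: nx; exists x.
have [|lh [lhQ Hlh]] := @totally_bounded _ _ Q L m (M + K) (1 / 2) _ bound; first lra.
exists lh => h hE hH hK; have Qh : Q h by [].
have [h' [h'l close]] := Hlh h Qh.
have attained g x : Q g -> exists p, In p L /\ m p g = g x - D x p.1 /\
    same_cone d p.1 x p.2.
  move=> [gE [_ gK]]; have [y hy] := EX_tight geo lab gE x.
  have [|v [w [h1 [h2 h3]]]] := HL g gE gK x y; first lra.
  exists (v, w); split=> //; split=> //; apply: Glb_Rbar_attained.
    by exists x.
  move=> t [x' /= [hx' ->]].
  have /h3/hx' h4 := h2; have := gE.1 x' y; lra.
have m_le g g' x : Q g -> Q g' -> (forall p, In p L -> Rabs (m p g - m p g') < 1 / 2) ->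
    g x < g' x + 1 / 2.
  move=> Qg Qg' cl; have [p [pL [mp hp]]] := attained g x Qg.
  have [|h4 h5] := @Glb_Rbar_le _ (g' x - D x p.1) (- g' p.1) _ (lowb g' p Qg'); first by exists x.
  have [h6 h7] := Rabs_def2 _ _ (cl _ pL); rewrite /m in mp h6 h7; lra.
have Qh' : Q h' by apply: lhQ.
suff -> : h = h' by [].
apply: functional_extensionality => x; apply: half_integer_close (hH x) (Qh'.2.1 x) _.
have h1 := m_le h h' x Qh Qh' close.
have h2 : h' x < h x + 1 / 2.
  by apply: m_le => // p /close; rewrite Rabs_minus_sym.
by apply: Rabs_def1; lra.
Qed.

Lemma rounding_separates (g : X -> R) (x y : X) : EX d g -> g x + g y <> D x y ->
  exists h, in_cell d g h /\ (forall u, half_integer (h u)) /\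
    (forall u, Rabs (h u - g u) <= 1 / 2) /\ h x + h y <> D x y.
Proof.
move=> gE ne; exists (fun u => rounding (- g x) (g u)); split; first exact: rounding_in_cell gE.1.
split=> [u|]; first exact: rounding_half.
split=> [u|]; first exact: rounding_close.
have gt : D x y - g y < g x by have := gE.1 x y; lra.
by have := rounding_sep gt; rewrite rounding_reflect; lra.
Qed.

(* A set of tight pairs is the intersection of the sets of tight pairs of the
   half-integral functions in its cell, and there are finitely many of those. *)
Lemma finite_tight_sets (f0 : X -> R) (K : R) : exists lg : list (X -> R),
  (forall g, In g lg -> EX d g) /\
  forall g, EX d g -> (forall x, Rabs (g x - f0 x) <= K) ->
  exists g', In g' lg /\ forall x y, g x + g y = D x y <-> g' x + g' y = D x y.
Proof.
have [lh Hlh] := finite_half_integral f0 (K + 1 / 2).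
have [ll Hll] := sublists lh.
pose Q g := EX d g /\ forall x, Rabs (g x - f0 x) <= K.
have [g _|lg [h1 h2]] := @finite_reps (X -> R) (list (X -> R)) Q
    (fun g l => forall h, In h l <-> In h lh /\ in_cell d g h) ll.
  by have [l [l1 l2]] := Hll (in_cell d g); exists l.
exists lg; split=> [g /h1 []//|g gE gK].
have [//|g' [l [g'l [_ [Tg Tg']]]]] := h2 g.
exists g'; split=> //.
have [g'E g'K] := h1 _ g'l.
have incl u u' x y : Q u -> EX d u' ->
    (forall h, In h l <-> In h lh /\ in_cell d u h) ->
    (forall h, In h l <-> In h lh /\ in_cell d u' h) ->
    u' x + u' y = D x y -> u x + u y = D x y.
  move=> [uE uK] u'E Tu Tu' e; apply: NNPP => ne.
  have [h [hc [hh [hu hne]]]] := rounding_separates uE ne.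
  apply: hne; suff /Tu' [_ [_ H]] : In h l by apply: H.
  apply/Tu; split=> //; apply: Hlh => // [|z]; first exact: in_cell_EX hc.
  have /Rabs_le_inv h3 := hu z; have /Rabs_le_inv h4 := uK z; apply: Rabs_le; lra.
by move=> x y; split; apply: incl => //; split.
Qed.

(** The tight pairs of a midpoint are those common to both ends. As only finitely many tight sets
    occur, finitely many midpoints reach one contained in all the others. *)
Lemma minimal_tight_set (S : (X -> R) -> Prop) (f0 : X -> R) (K : R) :
  (forall f, S f -> EX d f) -> (forall f, S f -> forall x, Rabs (f x - f0 x) <= K) ->
  (forall f g, S f -> S g -> S (fun x => (f x + g x) / 2)) -> (exists f, S f) ->
  exists f, S f /\ forall g, S g -> in_cell d f g.
Proof.
move=> SE SK Smid [f1 Sf1]; have [lg [_ Hlg]] := finite_tight_sets f0 K.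
have [g Sg|lu [h1 h2]] := @finite_reps (X -> R) (X -> R) S
    (fun g g' => forall x y, g x + g y = D x y <-> g' x + g' y = D x y) lg.
  by have [g' [g'l H]] := Hlg g (SE _ Sg) (SK _ Sg); exists g'.
have [f [Sf Hf]] : exists f, S f /\ forall g, In g lu -> in_cell d f g.
  elim: {h2} lu h1 => [|g lu IH] h1; first by exists f1.
  have [|f [Sf Hf]] := IH; first by move=> u ul; apply: h1; right.
  have Sg : S g by apply: h1; left.
  exists (fun x => (f x + g x) / 2); split; first exact: Smid.
  move=> u /= [<-|ul]; first split=> [|x y e]; first exact: (SE _ Sg).1.
    by have := (SE _ Sf).1 x y; have := (SE _ Sg).1 x y; lra.
  have [uD H] := Hf u ul; split=> // x y e; apply: H.
  by have := (SE _ Sf).1 x y; have := (SE _ Sg).1 x y; lra.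
exists f; split=> // g Sg; split=> [|x y e]; first exact: (SE _ Sg).1.
have [u [v [ul [_ [T1 T2]]]]] := h2 g Sg.
by apply/T1/T2; apply: (Hf u ul).2.
Qed.

(** Any positive share of [g] keeps its non-tight pairs strict, while its tight pairs persist
    throughout the cell. *)
Lemma in_cell_segment (g f : X -> R) (s : R) : EX d g -> in_cell d g f -> 0 < s <= 1 ->
  EX d (fun x => f x + s * (g x - f x)) /\
  forall x y, g x + g y = D x y <->
    (f x + s * (g x - f x)) + (f y + s * (g y - f y)) = D x y.
Proof.
move=> gE gf s01; have [gD _] := gE; have [fD H] := gf.
have T x y : g x + g y = D x y <->
    (f x + s * (g x - f x)) + (f y + s * (g y - f y)) = D x y.
  split=> [e|e]; first by have := H _ _ e; nra.
  have := gD x y; have := fD x y; nra.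
split=> //; apply: EX_intro => // [x y|x].
  by have := gD x y; have := fD x y; nra.
by have [y /T hy] := EX_tight geo lab gE x; exists y.
Qed.

(** [f] is a relative interior point of its own cell: its non-tight pairs have slack at least [eta],
    and an extension by [e] consumes at most [2 * M * e] of it. *)
Lemma in_cell_reflect (f h : X -> R) : EX d f -> in_cell d f h ->
  exists e, 0 < e /\ in_cell d f (fun x => f x + e * (f x - h x)).
Proof.
move=> fE fh; have hE := in_cell_EX geo lab fE fh.
have [M [M0 HM]] := EX_bounded geo fE hE.
have [eta [eta0 He]] := EX_gap geo lab fE.
pose e := eta / (2 * M + 1).
have e0 : 0 < e by apply: Rdiv_lt_0_compat; lra.
have eM : e * (2 * M) <= eta.
  have : e * (2 * M + 1) = eta by rewrite /e; field; lra.
  nra.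
exists e; split=> //; split=> x y; last by move=> hf; have := fh.2 _ _ hf; nra.
have [hf|hf] := Req_dec (f x + f y) (D x y); first by have := fh.2 _ _ hf; nra.
have := He x y; have := fE.1 x y => h1 h2; have {}h2 := h2 ltac:(lra).
have /Rabs_le_inv := HM x; have /Rabs_le_inv := HM y; nra.
Qed.

End Space.

(** * Signed coordinates, convex hulls and averages of roundings *)

HB.instance Definition _ := Monoid.isComLaw.Build R 0 Rplus
  (fun x y z => esym (Rplus_assoc x y z)) Rplus_comm Rplus_0_l.

Lemma big_Rmult (I : Type) (r : seq I) (P : pred I) (c : R) (F : I -> R) :
  \big[Rplus/0]_(i <- r | P i) (c * F i) = c * \big[Rplus/0]_(i <- r | P i) F i.
Proof.
by symmetry; apply: (big_morph (Rmult c)) => [x y|]; [exact: Rmult_plus_distr_l|exact: Rmult_0_r].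
Qed.

Lemma big_Rle (I : Type) (r : seq I) (P : pred I) (F G : I -> R) :
  (forall i, P i -> F i <= G i) ->
  \big[Rplus/0]_(i <- r | P i) F i <= \big[Rplus/0]_(i <- r | P i) G i.
Proof.
move=> H; apply: (big_ind2 Rle) => //; first exact: Rle_refl.
move=> *; exact: Rplus_le_compat.
Qed.

Lemma fin_list (T : finType) : exists l : list T, forall x, In x l.
Proof.
exists (enum T) => x; have : x \in enum T by rewrite mem_enum.
elim: (enum T) => // y s IH; rewrite inE => /orP[/eqP ->|/IH]; by [left|right].
Qed.

Lemma fin_bounded (T : finType) (F : T -> R) : exists M, 0 <= M /\ forall x, Rabs (F x) <= M.
Proof.
have [l Hl] := fin_list T.
suff [M [M0 HM]] : exists M, 0 <= M /\ forall x, In x l -> Rabs (F x) <= M.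
  by exists M; split=> // x; apply: HM.
elim: l {Hl} => [|y l [M [M0 HM]]]; first by exists 0; split; [lra|].
exists (Rmax M (Rabs (F y))); split; first by apply: Rle_trans M0 (Rmax_l _ _).
by move=> x /= [<-|/HM h]; [exact: Rmax_r|apply: Rle_trans h (Rmax_l _ _)].
Qed.

Lemma supd_le (T : Type) (f g : T -> R) (M : R) :
  0 <= M -> (forall z, Rabs (f z - g z) <= M) -> supd f g <= M.
Proof.
move=> M0 H; rewrite /supd.
have [h1 h2] := Lub_Rbar_correct (fun t => t = 0 \/ exists z, t = Rabs (f z - g z)).
have h3 := h1 0 (or_introl erefl).
have : Rbar_le (Lub_Rbar (fun t => t = 0 \/ exists z, t = Rabs (f z - g z))) M.
  by apply: h2 => t [->|[z ->]] /=.
by move: h3; case: (Lub_Rbar _).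
Qed.

Lemma le_supd (T : Type) (f g : T -> R) (M : R) :
  (forall z, Rabs (f z - g z) <= M) ->
  0 <= supd f g /\ forall z, Rabs (f z - g z) <= supd f g.
Proof.
move=> H; rewrite /supd.
have [h1 h2] := Lub_Rbar_correct (fun t => t = 0 \/ exists z, t = Rabs (f z - g z)).
have h3 := h1 0 (or_introl erefl).
have h4 : Rbar_le (Lub_Rbar (fun t => t = 0 \/ exists z, t = Rabs (f z - g z))) (Rmax 0 M).
  apply: h2 => t [->|[z ->]] /=; first exact: Rmax_l.
  by apply: Rle_trans (H z) (Rmax_r _ _).
have h5 z := h1 _ (or_intror (ex_intro _ z erefl)).
by move: h3 h4 h5; case: (Lub_Rbar _).
Qed.

Lemma linf_coord (n : nat) (p q : Rn n) : 0 <= linf p q /\ forall i, Rabs (p i - q i) <= linf p q.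
Proof. by have [M [_ HM]] := fin_bounded (fun i => p i - q i); apply: le_supd HM. Qed.

(** On a cell, the displacement at a point is zero or a coordinate up to sign; tight partners have
    opposite displacements. *)
Definition signed (n : nat) := option ('I_n * bool).

Definition sval n (a : signed n) (p : Rn n) : R :=
  match a with
  | None => 0
  | Some (i, true) => p i
  | Some (i, false) => - p i
  end.

Definition sopp n (a : signed n) : signed n :=
  match a with None => None | Some (i, b) => Some (i, ~~ b) end.

Lemma sval_opp n (a : signed n) (p : Rn n) : sval (sopp a) p = - sval a p.
Proof. case: a => [[i [|]]|] /=; lra. Qed.

Lemma sval_comb n (a : signed n) (u v : R) (p q : Rn n) :
  sval a (fun i => u * p i + v * q i) = u * sval a p + v * sval a q.
Proof. case: a => [[i [|]]|] /=; lra. Qed.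

Lemma sval_linf n (a : signed n) (p q : Rn n) : Rabs (sval a p - sval a q) <= linf p q.
Proof.
have [h1 h2] := linf_coord p q; case: a => [[i [|]]|] /=; first exact: h2.
  by have := h2 i; rewrite -Rabs_Ropp; congr (Rabs _ <= _); lra.
by rewrite Rminus_diag Rabs_R0.
Qed.

Lemma sval_sum n (a : signed n) (m : nat) (w : nat -> R) (q : nat -> Rn n) (x : Rn n) :
  (forall i, x i = \big[Rplus/0]_(k < m) (w k * q k i)) ->
  sval a x = \big[Rplus/0]_(k < m) (w k * sval a (q k)).
Proof.
case: a => [[i [|]]|] /= H //.
  rewrite H -[X in - X]Rmult_1_l Ropp_mult_distr_l -big_Rmult.
  by apply: eq_bigr => k _; lra.
by rewrite big1 // => k _; lra.
Qed.

(** * Nonnegative combinations with prescribed total weight *)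

Section ConvexHull.

Variable (n : nat).

(** [conv_hull] with an arbitrary total weight, so that the pieces of a step sum can be added one by
    one. *)
Definition cone_hull (L : list (Rn n)) (W : R) (x : Rn n) : Prop :=
  exists w : nat -> R,
    (forall k, 0 <= w k) /\
    \big[Rplus/0]_(k < size L) w k = W /\
    forall i, x i = \big[Rplus/0]_(k < size L) (w k * (nth (fun _ => 0) L k) i).

Lemma cone_hull0 (L : list (Rn n)) : cone_hull L 0 (fun _ => 0).
Proof.
exists (fun _ => 0); split=> [_|]; first exact: Rle_refl.
by split=> [|i]; rewrite big1 // => k _; lra.
Qed.

Lemma cone_hull_add (L : list (Rn n)) (W W' : R) (x y : Rn n) :
  cone_hull L W x -> cone_hull L W' y -> cone_hull L (W + W') (fun i => x i + y i).
Proof.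
move=> [w [h1 [h2 h3]]] [w' [h1' [h2' h3']]].
exists (fun k => w k + w' k); split=> [k|]; first by have := h1 k; have := h1' k; lra.
split=> [|i]; first by rewrite big_split /= h2 h2'.
by rewrite h3 h3' -big_split /=; apply: eq_bigr => k _; lra.
Qed.

Lemma cone_hull_point (L : list (Rn n)) (W : R) (q : Rn n) :
  In q L -> 0 <= W -> cone_hull L W (fun i => W * q i).
Proof.
move=> qL W0.
have [k kL] : exists k : 'I_(size L), nth (fun _ => 0) L k = q.
  elim: L qL => [//|p L IH] /= [<-|/IH [k kq]]; first by exists ord0.
  by exists (lift ord0 k).
exists (fun j : nat => if j == k then W else 0); split=> [j|]; first by case: ifP => _; lra.
have H (F : nat -> R) : \big[Rplus/0]_(j < size L) ((if nat_of_ord j == k then W else 0) * F j) = W * F k.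
  rewrite (bigD1 k) //= eqxx big1 ?Rplus_0_r // => j jk.
  by rewrite (_ : (nat_of_ord j == k) = false) ?Rmult_0_l //; apply: negbTE.
split=> [|i]; last by rewrite (H (fun j => nth (fun _ => 0) L j i)) kL.
by rewrite -[RHS]Rmult_1_r -(H (fun _ => 1)); apply: eq_bigr => j _; lra.
Qed.

End ConvexHull.

(** * Step functions and the average of the roundings of a real *)

Fixpoint chain (s : R) (l : list R) : Prop :=
  match l with nil => True | t :: l' => s <= t /\ chain t l' end.

(* The integral over [[s, last s l]] of the function that equals [F t] on the
   interval between [t] and its successor. *)
Fixpoint step_sum (F : R -> R) (s : R) (l : list R) : R :=
  match l with nil => 0 | t :: l' => (t - s) * F s + step_sum F t l' end.

Lemma chain_last (s : R) (l : list R) : chain s l -> s <= seq.last s l.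
Proof. elim: l s => [|t l IH] s /=; [lra|by move=> [h /IH]; lra]. Qed.

Lemma chain_In (s b : R) (l : list R) : chain s l -> In b l -> s <= b.
Proof. elim: l s => [//|t l IH] s /= [h c] [<-//|/(IH _ c)]; lra. Qed.

Lemma chain_insert (s b : R) (l : list R) : chain s l -> s <= b <= seq.last s l ->
  exists l', chain s l' /\ seq.last s l' = seq.last s l /\
    In b (s :: l') /\ forall c, In c (s :: l) -> In c (s :: l').
Proof.
elim: l s => [|t l IH] s /=.
  by move=> _ h; exists nil; do !split=> //; left; lra.
move=> [st c] h; have [bt|tb] := Rle_lt_dec b t.
  exists (b :: t :: l); split; first by do !split=> //; lra.
  split=> //; split=> [|x [->|[->|h']]]; first by right; left.
  - by left.
  - by do 2 right; left.
  - by do 3 right.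
have [|l' [h1 [h2 [h3 h4]]]] := IH t c; first lra.
exists (t :: l'); split=> //; split=> //; split=> [|x [->|/h4 h']]; first by right.
- by left.
- by right.
Qed.

Lemma exists_chain (bs : list R) : (forall b, In b bs -> 0 <= b <= 1) ->
  exists l, chain 0 l /\ seq.last 0 l = 1 /\ forall b, In b bs -> In b (0 :: l).
Proof.
elim: bs => [|b bs IH] H; first by exists (1 :: nil); do !split=> //=; lra.
have [|l [h1 [h2 h3]]] := IH; first by move=> c cb; apply: H; right.
have [|l' [h4 [h5 [h6 h7]]]] := @chain_insert 0 b l h1.
  by rewrite h2; apply: H; left.
exists l'; do !split=> //; first by rewrite h5.
by move=> c [<-//|/h3/h7].
Qed.

Lemma step_sum_const (F : R -> R) (c s : R) (l : list R) : chain s l ->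
  (forall t, s <= t < seq.last s l -> F t = c) -> step_sum F s l = (seq.last s l - s) * c.
Proof.
elim: l s => [|t l IH] s /=; first by move=> *; lra.
move=> [st ch] H; have tl := chain_last ch.
rewrite IH // => [|u tu]; last by apply: H; lra.
have [sl|sl] := Rle_lt_dec (seq.last t l) s; last by rewrite H; lra.
have e : seq.last t l = s by lra.
by rewrite e (_ : t = s); lra.
Qed.

Lemma step_sum_jump (F : R -> R) (c b s : R) (l : list R) : chain s l -> In b (s :: l) ->
  (forall t, t < b -> F t = c) -> (forall t, b <= t < seq.last s l -> F t = c + 1) ->
  step_sum F s l = (seq.last s l - s) * c + (seq.last s l - b).
Proof.
elim: l s => [|t l IH] s.
  by move=> _ [/= <-|//] _ _; lra.
move=> ch; have [sb|bs] := Rlt_le_dec s b; last first.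
  move=> hb _ H; rewrite (@step_sum_const F (c + 1)) //; last by move=> u hu; apply: H; lra.
  have -> : b = s; last lra.
  by case: hb => [//|/(chain_In ch)]; lra.
move: ch => /= [st ch] [e|hb] H1 H2; first lra.
by rewrite (IH t) // H1 //; lra.
Qed.

Lemma step_sum_lin (F G : R -> R) (u v s : R) (l : list R) :
  step_sum (fun t => u * F t + v * G t) s l = u * step_sum F s l + v * step_sum G s l.
Proof. elim: l s => [|t l IH] s /=; [lra|rewrite IH; lra]. Qed.

(* The jump of [t |-> floor (a + t)] on [[0, 1]] is at [b = floor a + 1 - a]. *)
Lemma floor_average (a : R) (l : list R) : chain 0 l -> seq.last 0 l = 1 ->
  In (IZR (Int_part a) + 1 - a) (0 :: l) ->
  step_sum (fun t => IZR (Int_part (a + t))) 0 l = a.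
Proof.
move=> ch l1 hb; have h := base_Int_part a.
have F z t : IZR z <= a + t < IZR z + 1 -> IZR (Int_part (a + t)) = IZR z.
  by move=> hz; congr IZR; symmetry; apply: Int_part_spec; lra.
have pos t : In t (0 :: l) -> 0 <= t by move=> [<-|/(chain_In ch)]; lra.
(* [step_sum_jump] wants one constant value everywhere before the jump, so the floor is frozen at
   negative arguments, which the sum never samples. *)
pose G t := if Rlt_dec t 0 then IZR (Int_part a) else IZR (Int_part (a + t)).
have GF : forall s, 0 <= s -> forall l', chain s l' ->
    step_sum G s l' = step_sum (fun t => IZR (Int_part (a + t))) s l'.
  move=> s s0 l'; elim: l' s s0 => [//|t l' IH] s s0 /= [st c].
  by rewrite IH // /G; [case: Rlt_dec => // h1; exfalso; lra|lra].
rewrite -(GF 0) //; last lra.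
rewrite (@step_sum_jump G (IZR (Int_part a)) _ 0 l ch hb) ?l1; first lra.
  by move=> t tb; rewrite /G; case: Rlt_dec => // t0; apply: F; lra.
move=> t tb; rewrite /G; case: Rlt_dec => t0; first lra.
by rewrite -plus_IZR; apply: F; rewrite plus_IZR; lra.
Qed.

(** Over an offset in the unit interval the two floors in [rounding] average to [r] and [- r]. One
    subdivision containing all their jumps serves the whole list. *)
Lemma rounding_average (rs : list R) : exists l, chain 0 l /\ seq.last 0 l = 1 /\
  forall r, In r rs -> step_sum (fun s => rounding s r) 0 l = r.
Proof.
pose br a := IZR (Int_part a) + 1 - a.
have [b|l [h1 [h2 h3]]] := @exists_chain (map br rs ++ map (fun r => br (- r)) rs).
  by rewrite in_app_iff !in_map_iff => -[[r [<- _]]|[r [<- _]]]; rewrite /br;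
    [have := base_Int_part r|have := base_Int_part (- r)]; lra.
exists l; split=> //; split=> // r hr.
have e1 : step_sum (fun t => IZR (Int_part (r + t))) 0 l = r.
  apply: floor_average => //; apply: h3; rewrite -/(br r).
  by apply: in_or_app; left; apply: in_map.
have e2 : step_sum (fun t => IZR (Int_part (- r + t))) 0 l = - r.
  apply: floor_average => //; apply: h3; rewrite -/(br (- r)).
  by apply: in_or_app; right; apply: (in_map (fun r => br (- r))).
rewrite (_ : (fun s => rounding s r) = fun t =>
  / 2 * IZR (Int_part (r + t)) + - / 2 * IZR (Int_part (- r + t))).
  by rewrite step_sum_lin e1 e2; lra.
apply: functional_extensionality => t; rewrite /rounding (Rplus_comm (- r)).
by rewrite /Rminus; lra.
Qed.

Lemma step_sum_cone_hull n (L : list (Rn n)) (F : R -> Rn n) (s : R) (l : list R) :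
  (forall t, In (F t) L) -> chain s l ->
  cone_hull L (seq.last s l - s) (fun i => step_sum (fun t => F t i) s l).
Proof.
move=> H; elim: l s => [|t l IH] s /=; first by rewrite Rminus_diag => _; exact: cone_hull0.
move=> [st /IH h]; have -> : seq.last t l - s = (t - s) + (seq.last t l - t) by lra.
by apply: cone_hull_add h; apply: cone_hull_point => //; lra.
Qed.

Lemma half_integer_box (n : nat) (B : R) : exists L : list (Rn n), forall q : Rn n,
  (forall i, half_integer (q i)) -> (forall i, Rabs (q i) <= B) -> In q L.
Proof.
have [li Hli] := fin_list 'I_n.
pose Q (q : Rn n) := (forall i, half_integer (q i)) /\ forall i, Rabs (q i) <= B.
have [|q i [_ qB] _|L [h1 h2]] := @totally_bounded (Rn n) 'I_n Q li (fun i q => q i) B (1 / 2).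
- lra.
- exact: qB.
exists L => q hq qB; have [//|q' [q'L H]] := h2 q.
suff -> : q = q' by [].
apply: functional_extensionality => i; apply: half_integer_close => //.
- exact: (h1 _ q'L).1.
- exact: H.
Qed.

(** * Charted cells *)

(** Cutting the loops out of the walk leaves fewer than [#|T|] steps. *)
Lemma finite_walk (T : finType) (F : T -> R) (K : R) (t : nat -> T) (m : nat) : 0 <= K ->
  (forall k, (k < m)%coq_nat -> Rabs (F (t k) - F (t (S k))) <= K) ->
  Rabs (F (t 0%nat) - F (t m)) <= INR #|T| * K.
Proof.
move=> K0 H.
pose e a b : bool := Rle_dec (Rabs (F a - F b)) K.
have [p [pth lst]] : exists p, path e (t 0%nat) p /\ seq.last (t 0%nat) p = t m.
  elim: m H => [|m IH] H; first by exists nil.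
  have [|p [pth lst]] := IH; first by move=> k km; apply: H; lia.
  exists (rcons p (t (S m))); rewrite rcons_path last_rcons pth lst; split=> //=.
  by rewrite /e; case: Rle_dec => //; have := H m ltac:(lia).
rewrite -lst; case/shortenP: pth => p' pth' uq _ {lst}.
have /INR_le h : INR (size p') <= INR #|T|.
  apply: le_INR; apply/leP; apply: ltnW.
  by have /card_uniqP /= <- := uq; apply: max_card.
apply: (@Rle_trans _ (INR (size p') * K)); last first.
  by apply: Rmult_le_compat_r => //; apply: le_INR.
elim: p' (t 0%nat) pth' {uq h} => [|a p' IH] x.
  by rewrite /= Rminus_diag Rabs_R0; lra.
rewrite [size _]/= S_INR /= => /andP[xa /IH h].
have : Rabs (F x - F a) <= K by move: xa; rewrite /e; case: Rle_dec.
have := Rabs_triang (F x - F a) (F a - F (seq.last a p')).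
have -> : F x - F a + (F a - F (seq.last a p')) = F x - F (seq.last a p') by lra.
rewrite Rmult_plus_distr_r Rmult_1_l; move=> h1 h2.
by apply: Rle_trans h1 _; rewrite Rplus_comm; apply: Rplus_le_compat.
Qed.

(** The dimensions are variables here so that [subst] can identify them, which the projections
    [cdim c] do not allow. Two hulls of half-integral points coincide once they contain the same
    half-integral points. *)
Lemma polytope_cast (m m' n : nat) (P : Rn m -> Prop) (P' : Rn m' -> Prop) (e : m = n) (e' : m' = n) :
  (forall q : Rn n, (forall i, half_integer (q i)) ->
    P (fun i => q (cast_ord e i)) <-> P' (fun i => q (cast_ord e' i))) ->
  (exists L, (forall q, In q L -> P q /\ forall i, half_integer (q i)) /\
     forall x, P x <-> conv_hull L x) ->
  (exists L, (forall q, In q L -> P' q /\ forall i, half_integer (q i)) /\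
     forall x, P' x <-> conv_hull L x) ->
  (forall L x, (forall q, In q L -> P q) -> conv_hull L x -> P x) ->
  (forall L x, (forall q, In q L -> P' q) -> conv_hull L x -> P' x) ->
  exists (f : Rn m -> Rn m') (g : Rn m' -> Rn m),
    (forall p, P p -> P' (f p)) /\ (forall p, P' p -> P (g p)) /\
    (forall p, f (g p) = p) /\ (forall p q, linf (f p) (f q) = linf p q).
Proof.
subst m m' => H [L [HL hL]] [L' [HL' hL']] hull hull'.
have {}H (q : Rn n) : (forall i, half_integer (q i)) -> P q <-> P' q.
  have E : (fun i => q (cast_ord erefl i)) = q.
    by apply: functional_extensionality => i; rewrite cast_ord_id.
  by move/H; rewrite E.
exists id, id; split; [|split; [|by []]] => p.
  by move/hL; apply: hull' => q /HL [qP qh]; apply/H.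
by move/hL'; apply: hull => q /HL' [qP qh]; apply/H.
Qed.

Definition affine_chart (X : Type) (n : nat) (b : X -> R) (t : X -> signed n) (p : Rn n) : X -> R :=
  fun x => b x + sval (t x) p.

(* [base] is a half-integral point of the cell, used as its origin. By [center], the cell
   consists of the functions of [Delta] whose tight pairs contain those of some [g]. *)
Record cell_data (X : Type) (d : X -> X -> nat) := CellData {
  cdim : nat;
  base : X -> R;
  typ : X -> signed cdim;
  base_half : forall x, half_integer (base x);
  base_Delta : Delta d base;
  typ_coord : forall i, exists x, typ x = Some (i, true);
  typ_partner : forall x, exists y, base x + base y = INR (d x y) /\ typ y = sopp (typ x);
  interior : full_dim (fun p => Delta d (affine_chart base typ p));
  center : exists g, EX d g /\ forall f, in_cell d g f <->
    exists p, Delta d (affine_chart base typ p) /\ affine_chart base typ p = f }.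

Section Space.

Variables (X : Type) (d : X -> X -> nat).
Notation D x y := (INR (d x y)).
Hypothesis geo : discretely_geodesic d.

Section Cell.

Variable c : cell_data d.

Definition cchart (p : Rn (cdim c)) : X -> R := affine_chart (base c) (typ c) p.
Definition cpoly (p : Rn (cdim c)) : Prop := Delta d (cchart p).

Lemma cchart_coord (i : 'I_(cdim c)) :
  exists x, typ c x = Some (i, true) /\ forall p, cchart p x = base c x + p i.
Proof. by have [x hx] := typ_coord i; exists x; rewrite /cchart /affine_chart hx. Qed.

Lemma cpoly_EX (p : Rn (cdim c)) : cpoly p -> EX d (cchart p).
Proof.
move=> pP; apply: EX_intro => // x; have [y [hy ty]] := typ_partner c x.
by exists y; rewrite /cchart /affine_chart ty sval_opp; lra.
Qed.

(** Every displacement is a signed coordinate or zero, and every coordinate occurs as a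
    displacement. *)
Lemma cchart_dist (p q : Rn (cdim c)) : Edist (cchart p) (cchart q) = linf p q.
Proof.
have H x : Rabs (cchart p x - cchart q x) <= linf p q.
  have := sval_linf (typ c x) p q; congr (Rabs _ <= _).
  by rewrite /cchart /affine_chart; lra.
have [h0 _] := linf_coord p q; have [h1 h2] := le_supd H.
apply: Rle_antisym; first exact: supd_le.
apply: supd_le => // i; have [x [_ hx]] := cchart_coord i.
by have := h2 x; rewrite !hx; congr (Rabs _ <= _); lra.
Qed.

Lemma cchart_inj (p q : Rn (cdim c)) : cchart p = cchart q -> p = q.
Proof.
move=> e; apply: functional_extensionality => i; have [x [_ hx]] := cchart_coord i.
have := hx p; rewrite e hx; lra.
Qed.

Lemma cchart0 : cchart (fun _ => 0) = base c.
Proof.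
apply: functional_extensionality => x; rewrite /cchart /affine_chart.
by case: (typ c x) => [[i [|]]|] /=; lra.
Qed.

Lemma cpoly0 : cpoly (fun _ => 0).
Proof. rewrite /cpoly cchart0; exact: base_Delta. Qed.

(* Along a geodesic from a point with value [p i] up to a constant to one with
   value [- p i] up to a constant, only finitely many types occur, and consecutive
   types differ little because the functions are 1-Lipschitz. *)
Lemma cpoly_bound (p : Rn (cdim c)) (i : 'I_(cdim c)) :
  cpoly p -> Rabs (p i) <= INR #|{: signed (cdim c)}|.
Proof.
move=> pP; have [x hx] := typ_coord i; have [y [_ ty]] := typ_partner c x.
rewrite hx /= in ty.
have [_ g] := geo; have [gam [g0 [g1 H]]] := g x y.
have lip := EX_lip geo (cpoly_EX pP); have lip0 := EX_lip geo (cpoly_EX cpoly0).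
have := @finite_walk (signed (cdim c)) (fun a => sval a p) 2 (fun k => typ c (gam k)) (d x y).
rewrite g0 g1 hx ty /= => /(_ ltac:(lra)) W.
have {}W : Rabs (p i - - p i) <= INR #|{: signed (cdim c)}| * 2.
  apply: W => k km.
  have dk : D (gam k) (gam k.+1) = 1.
    rewrite H; try (by apply/leP; lia).
    by rewrite S_INR Rabs_left1; lra.
  have := lip (gam k) (gam k.+1); have := lip (gam k.+1) (gam k).
  have := lip0 (gam k) (gam k.+1); have := lip0 (gam k.+1) (gam k).
  rewrite (D_sym geo (gam k.+1)) dk !cchart0 /cchart /affine_chart => *.
  by apply: Rabs_le; lra.
move/Rabs_le_inv: W => W; apply: Rabs_le; lra.
Qed.

Lemma cpoly_rounding (p : Rn (cdim c)) (s : R) : cpoly p ->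
  exists q, cpoly q /\ (forall x, cchart q x = rounding s (cchart p x)) /\
    forall i, half_integer (q i).
Proof.
move=> pP; have [g [gE Hg]] := center c.
have [fD fT] : in_cell d g (cchart p) by apply/Hg; exists p.
have [rD rT] := rounding_in_cell s fD.
have /Hg [q [qP qe]] : in_cell d g (fun x => rounding s (cchart p x)).
  by split=> // x y /fT/rT.
have hq x : cchart q x = rounding s (cchart p x) by rewrite /cchart qe.
exists q; do 2?split=> //.
move=> i; have [x [_ hx]] := cchart_coord i.
have [k hk] := rounding_half s (cchart p x); have [k' hk'] := base_half c x.
exists (k - k')%Z; rewrite minus_IZR -hk -hk' -hq hx; lra.
Qed.

Lemma cpoly_hull (L : list (Rn (cdim c))) (x : Rn (cdim c)) :
  (forall q, In q L -> cpoly q) -> conv_hull L x -> cpoly x.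
Proof.
move=> LP [w [w0 [w1 wx]]] u v; rewrite /cchart /affine_chart.
have Lk (k : 'I_(size L)) : In (nth (fun _ => 0) L k) L.
  elim: {LP w0 w1 wx} L k => [[]//|q L IH] [[|k] hk] /=; first by left.
  by right; apply: (IH (Ordinal (hk : (k < size L)%N))).
rewrite !(sval_sum _ wx); set S1 := bigop _ _ _; set S2 := bigop _ _ _.
suff : D u v - base c u - base c v <= S1 + S2 by lra.
rewrite -[X in X <= _]Rmult_1_r -w1 -big_Rmult -big_split /=.
apply: big_Rle => k _; have := LP _ (Lk k) u v; rewrite /cchart /affine_chart.
have := w0 k; nra.
Qed.

(** The point is the average of its roundings over the offset, and these are half-integral points of
    the polytope. One subdivision is exact for all coordinates, so the average is a finite convex
    combination. *)
Lemma cpoly_in_hull (L : list (Rn (cdim c))) (x : Rn (cdim c)) :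
  (forall q, cpoly q -> (forall i, half_integer (q i)) -> In q L) ->
  cpoly x -> conv_hull L x.
Proof.
move=> HL xP.
have [li Hli] := fin_list 'I_(cdim c).
have [rep Hrep] : exists rep : 'I_(cdim c) -> X, forall i p, cchart p (rep i) = base c (rep i) + p i.
  exists (fun i => proj1_sig (constructive_indefinite_description _ (cchart_coord i))) => i p.
  by case: constructive_indefinite_description => x0 [_ h] /=.
have [l [ch [l1 Hl]]] := rounding_average (map (fun i => cchart x (rep i)) li).
have HF s := constructive_indefinite_description _ (cpoly_rounding s xP).
have : cone_hull L (seq.last 0 l - 0) (fun i => step_sum (fun s => proj1_sig (HF s) i) 0 l).
  apply: step_sum_cone_hull => // s; case: (HF s) => q [h1 [h2 h3]] /=; exact: HL.
rewrite l1 Rminus_0_r; congr cone_hull.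
apply: functional_extensionality => i.
have e := Hl _ (in_map (fun i => cchart x (rep i)) _ _ (Hli i)).
have -> : (fun s => proj1_sig (HF s) i) =
    fun s => 1 * rounding s (cchart x (rep i)) + (- base c (rep i)) * 1.
  apply: functional_extensionality => s; case: (HF s) => q [h1 [h2 h3]] /=.
  by have := h2 (rep i); rewrite Hrep; lra.
rewrite step_sum_lin e (@step_sum_const _ 1) // l1 Hrep; lra.
Qed.

Lemma cpoly_vertices : exists L : list (Rn (cdim c)),
  (forall q, In q L -> cpoly q /\ forall i, half_integer (q i)) /\
  forall x, cpoly x <-> conv_hull L x.
Proof.
have [L0 H0] := half_integer_box (cdim c) (INR #|{: signed (cdim c)}|).
have [ll Hll] := sublists L0.
have [L [_ HL]] := Hll (fun q => cpoly q /\ forall i, half_integer (q i)).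
exists L; split=> [q /HL []//|x]; split=> [xP|]; last by apply: cpoly_hull => q /HL [_ []].
apply: cpoly_in_hull xP => q qP qh; apply/HL; split=> //.
by apply: H0 => // i; apply: cpoly_bound.
Qed.

End Cell.

Definition ccell : cell_data d -> (X -> R) -> Prop := cell cpoly cchart.

Lemma ccellP (c : cell_data d) : exists g, EX d g /\ forall f, ccell c f <-> in_cell d g f.
Proof. by have [g [gE H]] := center c; exists g; split=> // f; split; apply H. Qed.

Lemma isometric_of_vertices (n : nat) (c c' : cell_data d) (e : cdim c = n) (e' : cdim c' = n) :
  (forall q : Rn n, (forall i, half_integer (q i)) ->
    cpoly (fun i => q (cast_ord e i)) <-> cpoly (fun i => q (cast_ord e' i))) ->
  isometric (@Edist X) (ccell c) (ccell c').
Proof.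
move=> H.
have [cast [cast' [H1 [H2 [H3 H4]]]]] : exists (cast : Rn (cdim c) -> Rn (cdim c'))
    (cast' : Rn (cdim c') -> Rn (cdim c)),
    (forall p, cpoly p -> cpoly (cast p)) /\ (forall p, cpoly p -> cpoly (cast' p)) /\
    (forall p, cast (cast' p) = p) /\ (forall p q, linf (cast p) (cast q) = linf p q).
  by apply: polytope_cast H _ _ _ _; [exact: cpoly_vertices|exact: cpoly_vertices|exact: cpoly_hull|exact: cpoly_hull].
(* [epsilon] inverts the chart on the cell; elsewhere its value is arbitrary. *)
exists (fun f => cchart (cast (epsilon (inhabits (fun _ => 0)) (fun p => cpoly p /\ cchart p = f)))).
have hE p : cpoly p -> epsilon (inhabits (fun _ => 0)) (fun q => cpoly q /\ cchart q = cchart p) = p.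
  move=> pP; apply: cchart_inj.
  exact: (epsilon_spec (inhabits (fun _ => 0)) (fun q => cpoly q /\ cchart q = cchart p)
    (ex_intro _ p (conj pP erefl))).2.
split=> [f [p [pP <-]]|]; first by rewrite hE //; exists (cast p); split=> //; exact: H1.
split=> [f [p [pP <-]]|f f' [p [pP <-]] [q [qP <-]]].
  exists (cchart (cast' p)); rewrite hE; last exact: H2.
  by rewrite H3; split=> //; exists (cast' p); split=> //; exact: H2.
by rewrite !hE // !cchart_dist H4.
Qed.

(** A cell is the hull of its half-integral points. These lie in a box depending only on [n], which
    leaves finitely many possible sets of them. *)
Lemma finitely_many_isometry_types (n : nat) : exists l : list (cell_data d),
  forall c, cdim c = n -> exists c', In c' l /\ isometric (@Edist X) (ccell c) (ccell c').
Proof.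
have [L0 H0] := half_integer_box n (INR #|{: signed n}|).
have [ll Hll] := sublists L0.
have [c cn|l [h1 h2]] := @finite_reps (cell_data d) (list (Rn n)) (fun c => cdim c = n)
    (fun c l => exists e : cdim c = n, forall q, In q l <->
      In q L0 /\ cpoly (fun i => q (cast_ord e i))) ll.
  have [l [h1 h2]] := Hll (fun q => cpoly (c := c) (fun i => q (cast_ord cn i))).
  by exists l; split=> //; exists cn.
exists l => c cn; have [c' [l' [c'l [_ [[e He] [e' He']]]]]] := h2 c cn.
exists c'; split=> //; apply: (@isometric_of_vertices n c c' e e') => q qh.
have box (c0 : cell_data d) (e0 : cdim c0 = n) :
    cpoly (fun i => q (cast_ord e0 i)) -> In q L0.
  move=> /cpoly_bound B; apply: H0 => // i; have := B (cast_ord (esym e0) i).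
  have ec (m k : nat) : m = k -> #|{: signed m}| = #|{: signed k}| by move=> ->.
  by rewrite cast_ordKV (ec _ _ e0).
split=> qP; first by apply: (proj2 (_ : In q L0 /\ _)); apply/He'/He; split=> //; exact: box qP.
by apply: (proj2 (_ : In q L0 /\ _)); apply/He/He'; split=> //; exact: box qP.
Qed.

End Space.

(** * Injectivity of polytopes with octagonal facets *)

Section Lipschitz.

Variables (B : Type) (dB : B -> B -> R).
Hypothesis dBm : is_metric dB.

Lemma dB_ge0 (b b' : B) : 0 <= dB b b'.
Proof.
have [h1 [h2 h3]] := dBm; have := h3 b b' b; rewrite (h2 b' b).
by rewrite (_ : dB b b = 0); [lra|apply/h1].
Qed.

Definition lip (f : B -> R) := forall b b', f b <= f b' + dB b b'.

Lemma lip_const (r : R) : lip (fun _ => r).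
Proof. by move=> b b'; have := dB_ge0 b b'; lra. Qed.

Lemma lip_opp (f : B -> R) : lip f -> lip (fun b => - f b).
Proof. by move=> H b b'; have [_ [h2 _]] := dBm; have := H b' b; rewrite (h2 b' b); lra. Qed.

Lemma lip_add (f : B -> R) (r : R) : lip f -> lip (fun b => f b + r).
Proof. by move=> H b b'; have := H b b'; lra. Qed.

Lemma lip_min (us : list (B -> R)) (h : B -> R) : lip h -> (forall u, In u us -> lip u) ->
  exists g, lip g /\ forall b, g b <= h b /\ (forall u, In u us -> g b <= u b) /\
    forall t, t <= h b -> (forall u, In u us -> t <= u b) -> t <= g b.
Proof.
move=> hl; elim: us => [|u us IH] H; first by exists h; split=> // b; split; [lra|].
have [|g [gl Hg]] := IH; first by move=> w wl; apply: H; right.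
have ul : lip u by apply: H; left.
exists (fun b => Rmin (g b) (u b)); split=> [b b'|b].
  have := gl b b'; have := ul b b'.
  by rewrite {2}/Rmin; case: Rle_dec => _ h1 h2; [have := Rmin_l (g b) (u b)|have := Rmin_r (g b) (u b)]; lra.
have [h1 [h2 h3]] := Hg b.
have m1 := Rmin_l (g b) (u b); have m2 := Rmin_r (g b) (u b).
split; first lra.
split=> [w /= [<- //|/h2]|t th tu]; first lra.
apply: Rmin_glb; last by apply: tu; left.
by apply: h3 => // w wl; apply: tu; right.
Qed.

(** A minimum with the upper bounds, then a maximum with the lower ones, the latter as a minimum of
    opposites. Values of [h] already within the bounds survive, so prescribed values are kept. *)
Lemma lip_clamp (ls us : list (B -> R)) (h : B -> R) : lip h ->
  (forall l, In l ls -> lip l) -> (forall u, In u us -> lip u) ->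
  (forall l u b, In l ls -> In u us -> l b <= u b) ->
  exists g, lip g /\ forall b, (forall l, In l ls -> l b <= g b) /\
    (forall u, In u us -> g b <= u b) /\
    ((forall l, In l ls -> l b <= h b) -> (forall u, In u us -> h b <= u b) -> g b = h b).
Proof.
move=> hl Hl Hu Hlu.
have [h1 [h1l H1]] := lip_min hl Hu.
have [||g [gl H2]] := @lip_min (map (fun l b => - l b) ls) (fun b => - h1 b).
- exact: lip_opp.
- by move=> u /in_map_iff [l [<- /Hl]]; exact: lip_opp.
exists (fun b => - g b); split; first exact: lip_opp.
move=> b; have [a1 [a2 a3]] := H1 b; have [b1 [b2 b3]] := H2 b.
have lg l : In l ls -> l b <= - g b.
  by move=> hin; have := b2 _ (in_map (fun l b => - l b) _ _ hin); lra.
split=> //; split=> [u uus|lh hu].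
  suff : - u b <= g b by lra.
  apply: b3; first by have := a2 u uus; lra.
  by move=> w /in_map_iff [l [<- lls]]; have := Hlu l u b lls uus; lra.
have e : h1 b = h b.
  by apply: Rle_antisym => //; apply: a3 => //; lra.
suff : - h b <= g b by lra.
apply: b3; first lra.
by move=> w /in_map_iff [l [<- lls]]; have := lh l lls; lra.
Qed.

(** The extension is the infimum over [a] in [A] of [f a + dB a b]. *)
Lemma mcshane (A : B -> Prop) (f : B -> R) :
  (forall a a', A a -> A a' -> f a <= f a' + dB a a') ->
  exists h, lip h /\ forall a, A a -> h a = f a.
Proof.
move=> H; have [m1 [m2 m3]] := dBm.
have [[a0 A0]|nA] := classic (exists a, A a); last first.
  exists (fun _ => 0); split=> [|a Aa]; first exact: lip_const.
  by case: nA; exists a.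
pose S b t := exists a, A a /\ t = f a + dB a b.
have G b := @Glb_real (S b) (f a0 + dB a0 b) (f a0 - dB a0 b) (ex_intro _ a0 (conj A0 erefl)).
have {}G b : (forall u, S b u -> real (Glb_Rbar (S b)) <= u) /\
    (forall z, (forall u, S b u -> z <= u) -> z <= real (Glb_Rbar (S b))).
  apply: G => u [a [Aa ->]]; have := H a0 a A0 Aa; have := m3 a0 b a.
  by rewrite (m2 b a); have := m3 a0 a b; have := m3 a b a0; rewrite (m2 b a0) (m2 a a0); lra.
exists (fun b => real (Glb_Rbar (S b))); split=> [b b'|a Aa].
  suff : real (Glb_Rbar (S b)) - dB b b' <= real (Glb_Rbar (S b')) by lra.
  apply: (G b').2 => u [a [Aa ->]].
  have := (G b).1 _ (ex_intro _ a (conj Aa erefl)); have := m3 a b' b.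
  by rewrite (m2 b' b); lra.
apply: Rle_antisym.
  have := (G a).1 _ (ex_intro _ a (conj Aa erefl)).
  by rewrite (_ : dB a a = 0); [lra|apply/m1].
apply: (G a).2 => u [a' [Aa' ->]].
by have := H a a' Aa Aa'; rewrite (m2 a' a).
Qed.

End Lipschitz.

(* [c a b] is the least value of [sval a + sval b] on [P], so that these bounds are
   closed under composition. Eliminating one coordinate then leaves the bounds
   between the remaining ones, and the coordinates can be extended one by one:
   each is confined between 1-Lipschitz functions of the preceding ones. *)
Lemma octagon_injective (n : nat) (P : Rn n -> Prop) (p0 : Rn n) (K : R)
    (J : Type) (ta tb : J -> signed n) (r : J -> R) :
  P p0 -> (forall p i, P p -> Rabs (p i) <= K) ->
  (forall p, P p <-> forall i, r i <= sval (ta i) p + sval (tb i) p) ->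
  injective_space P (@linf n).
Proof.
move=> P0 PK PE B dB dBm A f fP fl.
pose S a b t := exists p, P p /\ t = sval a p + sval b p.
pose c a b := real (Glb_Rbar (S a b)).
have K0 : 0 <= Rabs K by apply: Rabs_pos.
have svK a p : P p -> - Rabs K <= sval a p.
  move=> pP; have KK := Rle_abs K.
  case: a => [[i [|]]|] /=; try lra; have /Rabs_le_inv := PK p i pP; lra.
have G a b : (forall u, S a b u -> c a b <= u) /\
    (forall z, (forall u, S a b u -> z <= u) -> z <= c a b).
  apply: (@Glb_real _ (sval a p0 + sval b p0) (- Rabs K - Rabs K)); first by exists p0.
  by move=> u [p [pP ->]]; have := svK a p pP; have := svK b p pP; lra.
have c_le a b p : P p -> c a b <= sval a p + sval b p.
  by move=> pP; apply: (G a b).1; exists p.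
have c_ge a b z : (forall p, P p -> z <= sval a p + sval b p) -> z <= c a b.
  by move=> H; apply: (G a b).2 => u [p [/H h ->]].
have c_sym a b : c a b <= c b a by apply: c_ge => p /(c_le a b); lra.
have c_tri a e b : c a e + c (sopp e) b <= c a b.
  by apply: c_ge => p pP; have := c_le a e p pP; have := c_le (sopp e) b p pP; rewrite sval_opp; lra.
have c_dbl a : c a a / 2 <= c a None by apply: c_ge => p /(c_le a a) /=; lra.
have c_opp a : c a (sopp a) <= 0 by have := c_le a (sopp a) p0 P0; rewrite sval_opp; lra.
pose low (k : nat) (a : signed n) := match a with None => True | Some (i, _) => (i < k)%coq_nat end.
have step k : (k <= n)%coq_nat -> exists G : B -> Rn n,
    (forall i : 'I_n, (i < k)%coq_nat -> lip dB (fun b => G b i)) /\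
    (forall (i : 'I_n) a, (i < k)%coq_nat -> A a -> G a i = f a i) /\
    (forall b a a', low k a -> low k a' -> c a a' <= sval a (G b) + sval a' (G b)).
  elim: k => [_|k IH kn].
    exists (fun _ => p0); split=> [i|]; first lia.
    split=> [i|b]; first lia.
    by move=> [[i e]|] [[i' e']|] //= h h'; try lia; apply: (c_le None None p0 P0).
  have [|F [Fl [FA Fc]]] := IH; first lia.
  have i0lt : (k < n)%N by apply/ltP; lia.
  pose i0 : 'I_n := Ordinal i0lt.
  pose kp : signed n := Some (i0, true); pose km : signed n := Some (i0, false).
  have ekp : sopp kp = km by []. have ekm : sopp km = kp by [].
  have [la Hla] : exists la, forall a, In a la <-> low k a.
    have [l0 H0] := fin_list (signed n); have [ll Hll] := sublists l0.
    have [la [_ H]] := Hll (low k); exists la => a; rewrite H; split=> [[]//|h]; by split.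
  have Fs a : low k a -> lip dB (fun b => sval a (F b)).
    case: a => [[i [|]]|] /= h; [exact: Fl|exact/(lip_opp dBm)/Fl|exact: lip_const].
  have FsA a x : low k a -> A x -> sval a (F x) = sval a (f x).
    by case: a => [[i [|]]|] //= h Ax; rewrite FA.
  have [|h [hl hA]] := @mcshane _ _ dBm A (fun a => f a i0).
    move=> a a' Aa Aa'; have := fl a a' Aa Aa'; have [_ /(_ i0)/Rabs_le_inv] := linf_coord (f a) (f a').
    lra.
  have [|||g [gl Hg]] := @lip_clamp _ _ dBm
      (map (fun a b => - sval a (F b) + c kp a) la) (map (fun a b => sval a (F b) + - c km a) la) h hl.
  - move=> l /in_map_iff [a [<- /Hla al]].
    by apply: lip_add; apply: lip_opp => //; apply: Fs.
  - by move=> u /in_map_iff [a [<- /Hla al]]; apply: lip_add; apply: Fs.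
  (* Lower bounds stay below upper ones: composing the two through the eliminated coordinate gives
     at most [c a a'], a bound that the coordinates already extended satisfy. *)
  - move=> l u b /in_map_iff [a [<- /Hla al]] /in_map_iff [a' [<- /Hla al']].
    by have := Fc b a a' al al'; have := c_tri a kp a'; have := c_sym kp a; rewrite ekp; lra.
  have Hg1 b a : low k a -> c kp a <= g b + sval a (F b).
    move=> /Hla al; have [H1 _] := Hg b.
    by have := H1 _ (in_map (fun a b => - sval a (F b) + c kp a) _ _ al); lra.
  have Hg2 b a : low k a -> c km a <= - g b + sval a (F b).
    move=> /Hla al; have [_ [H1 _]] := Hg b.
    by have := H1 _ (in_map (fun a b => sval a (F b) + - c km a) _ _ al); lra.
  exists (fun b i => if i == i0 then g b else F b i).
  have lowS (i : 'I_n) : (i < k.+1)%coq_nat -> i == i0 \/ (i == i0) = false /\ (i < k)%coq_nat.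
    move=> ik; case: eqP => [|ne]; [by left|right; split=> //].
    have : nat_of_ord i <> k by move=> e; apply: ne; apply: val_inj.
    lia.
  split=> [i /lowS [->|[-> ik]] //|]; first exact: Fl.
  split=> [i a /lowS [/eqP -> Aa|[-> ik]]|b]; last 2 first.
  - exact: FA.
  - have sv a : low k.+1 a -> a = kp \/ a = km \/ low k a /\
        sval a (fun i => if i == i0 then g b else F b i) = sval a (F b).
      case: a => [[i e]|] /= h'; last by right; right.
      have [/eqP ->|[ne ik]] := lowS i h'; first by case: e; [left|right; left].
      by right; right; split=> //; rewrite ne.
    have svp : sval kp (fun i => if i == i0 then g b else F b i) = g b by rewrite /= eqxx.
    have svm : sval km (fun i => if i == i0 then g b else F b i) = - g b by rewrite /= eqxx.
    (* The bounds against [None] confine [g b] itself; through [c_dbl] they settle the new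
       coordinate paired with itself. *)
    have n1 := Hg1 b None I; have n2 := Hg2 b None I; rewrite /= in n1 n2.
    move=> a a' /sv [->|[->|[al ->]]] /sv [->|[->|[al' ->]]]; rewrite ?svp ?svm.
    + by have := c_dbl kp; lra.
    + by have := c_opp kp; rewrite ekp; lra.
    + exact: Hg1.
    + by have := c_opp km; rewrite ekm; lra.
    + by have := c_dbl km; lra.
    + exact: Hg2.
    + by have := Hg1 b a al; have := c_sym a kp; lra.
    + by have := Hg2 b a al; have := c_sym a km; lra.
    + exact: Fc.
  (* On [A] the values of [f] lie in [P] and satisfy every bound, so clamping does not move them. *)
  rewrite eqxx -(hA _ Aa); have [_ [_ ->//]] := Hg a.
  + move=> l /in_map_iff [e [<- /Hla el]]; rewrite FsA // hA //.
    by have := c_le kp e _ (fP _ Aa); rewrite /=; lra.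
  + move=> l /in_map_iff [e [<- /Hla el]]; rewrite FsA // hA //.
    by have := c_le km e _ (fP _ Aa); rewrite /=; lra.
have [//|F [Fl [FA Fc]]] := step n.
have ordn (i : 'I_n) : (i < n)%coq_nat by apply/ltP.
have lown a : low n a by case: a => [[i e]|] //=.
exists F; split=> [b|].
  apply/PE => i; apply: Rle_trans (Fc b _ _ (lown _) (lown _)).
  by apply: c_ge => p /PE.
split=> [b b'|a Aa].
  apply: supd_le => [|i]; first exact: dB_ge0.
  have [_ [m2 _]] := dBm; have := Fl i (ordn i) b b'; have := Fl i (ordn i) b' b; rewrite (m2 b' b).
  by move=> *; apply: Rabs_le; lra.
by apply: functional_extensionality => i; apply: FA.
Qed.

(** * Choice of coordinates and existence of charted cells *)

Lemma independent_reps (X F : Type) (C : F -> Prop) (delta : X -> F -> R) (l : list X) :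
  exists (n : nat) (rep : 'I_n -> X),
    (forall i, ~ (forall f, C f -> delta (rep i) f = 0)) /\
    (forall i j, i <> j -> ~ (forall f, C f -> delta (rep i) f = delta (rep j) f) /\
       ~ (forall f, C f -> delta (rep i) f = - delta (rep j) f)) /\
    (forall x, In x l -> exists a, forall f, C f -> delta x f = sval a (fun i => delta (rep i) f)).
Proof.
elim: l => [|x l [n [rep [nz [ns cov]]]]].
  have e (T : Type) : 'I_0 -> T by case.
  by exists 0%N, (e X); do 2?split; try case.
(* A point becomes a new coordinate only if its displacement is neither zero nor an earlier one up
   to sign; linear independence is not sought. *)
have [cx|ncx] := classic (exists a, forall f, C f -> delta x f = sval a (fun i => delta (rep i) f)).
  by exists n, rep; do 2?split=> //; move=> y [<-|/cov].
pose rep' (i : 'I_n.+1) := if unlift ord0 i is Some j then rep j else x.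
have r0 : rep' ord0 = x by rewrite /rep' unlift_none.
have rl j : rep' (lift ord0 j) = rep j by rewrite /rep' liftK.
exists n.+1, rep'; split=> [i|].
  case: (unliftP ord0 i) => [j|] ->; rewrite ?rl ?r0; first exact: nz.
  by move=> H; apply: ncx; exists None.
split=> [i j|y /= yl].
  case: (unliftP ord0 i) => [i'|] ->; case: (unliftP ord0 j) => [j'|] ->; rewrite ?rl ?r0 => ij.
  - by apply: ns => e; apply: ij; rewrite e.
  - by split=> H; apply: ncx; [exists (Some (i', true))|exists (Some (i', false))] => f Cf /=;
      have := H f Cf; lra.
  - by split=> H; apply: ncx; [exists (Some (j', true))|exists (Some (j', false))] => f Cf /=;
      have := H f Cf; lra.
  - by [].
case: yl => [<-|/cov [[[i e]|] H]].
- by exists (Some (ord0, true)) => f _ /=; rewrite r0.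
- by exists (Some (lift ord0 i, e)) => f Cf; rewrite H //= rl.
- by exists None.
Qed.

(** Makes types well defined, so that tight partners have exactly opposite types and the [i]-th
    representative has type [Some (i, true)]. *)
Lemma sval_unique (n : nat) (F : Type) (C : F -> Prop) (u : F -> Rn n) :
  (forall i, ~ (forall f, C f -> u f i = 0)) ->
  (forall i j, i <> j -> ~ (forall f, C f -> u f i = u f j) /\
     ~ (forall f, C f -> u f i = - u f j)) ->
  forall a b, (forall f, C f -> sval a (u f) = sval b (u f)) -> a = b.
Proof.
move=> nz ns [[i e]|] [[j e']|] H //.
- have [ij|ij] := classic (i = j); last first.
    have [n1 n2] := ns i j ij.
    by case: e e' H => [] [] /= H; [case: n1|case: n2|case: n2|case: n1] => f Cf; have := H f Cf; lra.
  subst j; case: e e' H => [] [] //= H; case: (nz i) => f Cf; have := H f Cf; lra.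
- by case: (nz i) => f Cf; have := H f Cf; case: e {H} => /=; lra.
- by case: (nz j) => f Cf; have := H f Cf; case: e' {H} => /=; lra.
Qed.

Section Space.

Variables (X : Type) (d : X -> X -> nat).
Notation D x y := (INR (d x y)).
Hypothesis geo : discretely_geodesic d.
Hypothesis lab : same_cone_labels d.

Lemma exists_cell (g : X -> R) : EX d g ->
  exists c : cell_data d, forall f, ccell c f <-> in_cell d g f.
Proof.
move=> gE; have [l Hl] := cell_types geo lab gE.
have [n [rep [nz [ns cov]]]] := independent_reps (in_cell d g) (fun x f => f x - g x) l.
have uniq_type := sval_unique nz ns.
have Ht x : exists a : signed n, forall f, in_cell d g f ->
    f x - g x = sval a (fun i => f (rep i) - g (rep i)).
  have [x' [/cov [a Ha] e]] := Hl x; exists a => f Cf; rewrite e //; exact: Ha.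
pose t x := proj1_sig (constructive_indefinite_description _ (Ht x)).
have tP x f : in_cell d g f -> f x - g x = sval (t x) (fun i => f (rep i) - g (rep i)).
  by rewrite /t; case: constructive_indefinite_description => a /=; apply.
(* Rounding [g] gives a half-integral point of its cell, to which the displacements are re-based. *)
pose b x := rounding 0 (g x).
have bC : in_cell d g b by apply: rounding_in_cell gE.1.
have t_opp x y : g x + g y = D x y -> t y = sopp (t x).
  move=> e; apply: uniq_type => f Cf; rewrite sval_opp -!tP //; have := Cf.2 _ _ e; lra.
have chartP f : in_cell d g f -> affine_chart b t (fun i => f (rep i) - b (rep i)) = f.
  move=> Cf; apply: functional_extensionality => x; rewrite /affine_chart.
  by have := tP x f Cf; have := tP x b bC; case: (t x) => [[i [|]]|] /=; lra.
have chart_tight p x y : g x + g y = D x y -> affine_chart b t p x + affine_chart b t p y = D x y.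
  by move=> e; rewrite /affine_chart (t_opp x y e) sval_opp; have := bC.2 _ _ e; lra.
have b_half x : half_integer (b x) by apply: rounding_half.
have coord i : exists x, t x = Some (i, true).
  exists (rep i); apply: uniq_type => f Cf; by rewrite -tP.
have partner x : exists y, b x + b y = D x y /\ t y = sopp (t x).
  have [y hy] := EX_tight geo lab gE x; exists y; split; last exact: t_opp.
  exact: bC.2.
have int : full_dim (fun p => Delta d (affine_chart b t p)).
  have [eta [e0 He]] := EX_gap geo lab gE.
  (* Within [eta / 2] of the coordinates of [g], the sum over a pair drops by less than [eta], the
     least slack of a non-tight pair; tight pairs stay tight on the whole chart. *)
  exists (fun i => g (rep i) - b (rep i)), (eta / 2); split; first lra.
  move=> p hp x y; have [e|ne] := Req_dec (g x + g y) (D x y).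
    by rewrite chart_tight //; lra.
  have H z : Rabs (g z - affine_chart b t p z) < eta / 2.
    apply: Rle_lt_trans hp; have := sval_linf (t z) (fun i => g (rep i) - b (rep i)) p.
    congr (Rabs _ <= _); have := f_equal (fun h => h z) (chartP g (in_cell_refl gE)).
    by rewrite /= /affine_chart; lra.
  have [h1 _] := Rabs_def2 _ _ (H x); have [h2 _] := Rabs_def2 _ _ (H y).
  have := gE.1 x y; have := He x y; lra.
have cen f : in_cell d g f <->
    exists p, Delta d (affine_chart b t p) /\ affine_chart b t p = f.
  split=> [Cf|[p [pD <-]]]; last by split=> // x y; exact: chart_tight.
  by exists (fun i => f (rep i) - b (rep i)); rewrite chartP //; split=> //; exact: Cf.1.
exists (CellData b_half bC.1 coord partner int (ex_intro _ g (conj gE cen))) => f.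
by split=> [/cen|/cen].
Qed.

Lemma cpoly_injective (c : cell_data d) : injective_space (@cpoly X d c) (@linf (cdim c)).
Proof.
apply: (@octagon_injective (cdim c) _ _ _ (X * X) (fun q => typ c q.1) (fun q => typ c q.2)
  (fun q => D q.1 q.2 - base c q.1 - base c q.2)).
- exact: cpoly0.
- move=> p i; exact: cpoly_bound.
move=> p; split=> [H [x y] /=|H x y]; rewrite /cpoly /cchart /affine_chart.
  by have := H x y; rewrite /cchart /affine_chart; lra.
by have := H (x, y) => /=; lra.
Qed.

End Space.

(** * Faces and local finiteness *)

Lemma dot_comb (n : nat) (c p q : Rn n) (u v : R) :
  dot c (fun i => u * p i + v * q i) = u * dot c p + v * dot c q.
Proof.
rewrite /dot -!big_Rmult -big_split /=; apply: eq_bigr => i _; lra.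
Qed.

Lemma dot_addl (n : nat) (c c' p : Rn n) : dot (fun i => c i + c' i) p = dot c p + dot c' p.
Proof. by rewrite /dot -big_split /=; apply: eq_bigr => i _; lra. Qed.

Lemma sval_dot (n : nat) (a : signed n) : exists c : Rn n, forall p, dot c p = sval a p.
Proof.
have H (s : R) (i : 'I_n) p : dot (fun j => if j == i then s else 0) p = s * p i.
  rewrite /dot (bigD1 i) //= eqxx big1 ?Rplus_0_r // => j /negbTE ->; lra.
case: a => [[i [|]]|] /=.
- by exists (fun j => if j == i then 1 else 0) => p; rewrite H; lra.
- by exists (fun j => if j == i then -1 else 0) => p; rewrite H; lra.
- by exists (fun _ => 0) => p; rewrite /dot big1 // => i _; lra.
Qed.

Section Space.

Variables (X : Type) (d : X -> X -> nat).
Notation D x y := (INR (d x y)).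
Hypothesis geo : discretely_geodesic d.
Hypothesis lab : same_cone_labels d.

Lemma in_cell_trans (f g h : X -> R) : in_cell d f g -> in_cell d g h -> in_cell d f h.
Proof. by move=> [_ H] [hD H']; split=> // x y /H/H'. Qed.

Lemma in_cell_mid (f g h : X -> R) : in_cell d f g -> in_cell d f h ->
  in_cell d f (fun x => (g x + h x) / 2).
Proof.
move=> [gD gH] [hD hH]; split=> x y.
  by have := gD x y; have := hD x y; lra.
by move=> e; have := gH _ _ e; have := hH _ _ e; lra.
Qed.

Lemma cchart_comb (c : cell_data d) (u v : R) (p q : Rn (cdim c)) (x : X) : u + v = 1 ->
  cchart (fun i => u * p i + v * q i) x = u * cchart p x + v * cchart q x.
Proof. by move=> uv; rewrite /cchart /affine_chart sval_comb (_ : v = 1 - u); lra. Qed.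

Lemma ccell_bounded (c : cell_data d) (f : X -> R) (x : X) : ccell c f ->
  Rabs (f x - base c x) <= INR #|{: signed (cdim c)}|.
Proof.
move=> [p [pP <-]]; rewrite /cchart /affine_chart.
have -> : base c x + sval (typ c x) p - base c x = sval (typ c x) p by lra.
case: (typ c x) => [[i [|]]|] /=; rewrite ?Rabs_Ropp; try exact: cpoly_bound.
rewrite Rabs_R0; exact: pos_INR.
Qed.

(** The sum of the inequalities of the pairs in [l] is an equality exactly when each of them is. *)
Lemma tight_functional (c : cell_data d) (l : list (X * X)) :
  exists (a : Rn (cdim c)) (b : R), forall p, cpoly p ->
    dot a p <= b /\
    (dot a p = b <-> forall u, In u l -> cchart p u.1 + cchart p u.2 = D u.1 u.2).
Proof.
elim: l => [|[x y] l [a [b H]]].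
  exists (fun _ => 0), 0 => p _.
  have -> : dot (fun _ => 0) p = 0 by rewrite /dot big1 // => i _; lra.
  by split; [lra|split].
have [a1 H1] := sval_dot (typ c x); have [a2 H2] := sval_dot (typ c y).
have [a1' H1'] : exists a', forall p, dot a' p = - (sval (typ c x) p + sval (typ c y) p).
  have [b1 B1] := sval_dot (sopp (typ c x)); have [b2 B2] := sval_dot (sopp (typ c y)).
  by exists (fun i => b1 i + b2 i) => p; rewrite dot_addl B1 B2 !sval_opp; lra.
exists (fun i => a i + a1' i), (b + (base c x + base c y - D x y)) => p pP.
rewrite dot_addl H1'; have [h1 h2] := H p pP; have h3 := pP x y.
have e : cchart p x + cchart p y = base c x + base c y + (sval (typ c x) p + sval (typ c y) p).
  by rewrite /cchart /affine_chart; lra.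
split; first lra.
split=> [h|h].
  have /h2 h4 : dot a p = b by lra.
  by move=> u /= [<-|/h4//] /=; lra.
have -> : dot a p = b by apply/h2 => u ul; apply: h; right.
by have := h (x, y) (or_introl erefl) => /=; lra.
Qed.

(** For a pair tight at [f0], being tight elsewhere on the chart depends only on its two types.
    Finitely many pairs thus impose all the conditions, and their sum is a supporting functional. *)
Lemma subcell_is_face (c : cell_data d) (f0 : X -> R) : ccell c f0 ->
  exists F, is_face (cpoly (c := c)) F /\
    forall f, in_cell d f0 f <-> exists p, F p /\ cchart p = f.
Proof.
move=> c0; have [g [gE Hg]] := ccellP c.
have [lv Hlv] := fin_list ((signed (cdim c)) * (signed (cdim c)))%type.
have [u _|l [l1 l2]] := @finite_reps (X * X) _ (fun u => f0 u.1 + f0 u.2 = D u.1 u.2)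
    (fun u v => (typ c u.1, typ c u.2) = v) lv.
  by exists (typ c u.1, typ c u.2).
have [a [b H]] := tight_functional c l.
exists (fun p => cpoly p /\ dot a p = b); split.
  by right; exists a, b; split=> // p /H [].
have [p0 [p0P e0]] := c0.
move=> f; split=> [f0f|[p [[pP /(H p pP).2 hp] <-]]].
  have [p [pP pf]] : ccell c f by apply/Hg; apply: in_cell_trans f0f; apply/Hg.
  exists p; split=> //; split=> //; apply/(H p pP).2 => u ul; rewrite /= in pf; rewrite pf.
  exact: f0f.2 (l1 _ ul).
split=> // x y e; have [u [v [ul [_ [T1 T2]]]]] := l2 (x, y) e.
have h1 := hp u ul; have h2 := l1 u ul; move: e T1 T2 h1 h2.
rewrite /= in e0; rewrite -e0 /cchart /affine_chart /= => e <- [-> ->]; lra.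
Qed.

Lemma midpoint_closed_is_cell (c : cell_data d) (S : (X -> R) -> Prop) :
  (forall f, S f -> ccell c f) ->
  (forall f g, S f -> S g -> S (fun x => (f x + g x) / 2)) -> (exists f, S f) ->
  exists f, S f /\ EX d f /\ forall g, S g -> in_cell d f g.
Proof.
move=> Sc Sm Sn; have [g [gE Hg]] := ccellP c.
have SE f : S f -> EX d f by move=> /Sc/Hg; exact: in_cell_EX.
have [//|f [Sf H]] := minimal_tight_set geo lab SE (fun f Sf x => ccell_bounded x (Sc f Sf)) Sm.
by exists f; split=> //; split=> //; exact: SE.
Qed.

(** An exposed face is closed under midpoints, so it lies in the cell of one of its points [f].
    Conversely, a point [h] of that cell can be reflected slightly beyond [f]; the functional,
    maximal at [f], must then be maximal at [h]. *)
Lemma face_is_cell (c : cell_data d) (F : Rn (cdim c) -> Prop) :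
  is_face (cpoly (c := c)) F -> (exists p, F p) ->
  exists k : cell_data d, forall f, ccell k f <-> exists p, F p /\ cchart p = f.
Proof.
move=> [FP _|[a [b [ab Fab]]] [p1 Fp1]].
  by exists c => f; split=> [[p [/FP h1 h2]]|[p [/FP h1 h2]]]; exists p.
have [|g g' [p [/Fab [pP pb] <-]] [q [/Fab [qP qb] <-]]||f [[p [/Fab [pP pb] pf]] [fE fmin]]] :=
    @midpoint_closed_is_cell c (fun f => exists p, F p /\ cchart p = f).
- by move=> f [p [/Fab [pP _] <-]]; exists p.
- have e : cchart (fun i => / 2 * p i + / 2 * q i) = fun x => (cchart p x + cchart q x) / 2.
    by apply: functional_extensionality => x; rewrite cchart_comb; lra.
  exists (fun i => / 2 * p i + / 2 * q i); split=> //; apply/Fab; split.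
    by rewrite /cpoly e => x y; have := pP x y; have := qP x y; lra.
  by rewrite dot_comb pb qb; lra.
- by exists (cchart p1), p1.
have [k Hk] := exists_cell geo lab fE.
exists k => h; rewrite Hk; split=> [fh|]; last exact: fmin.
have [g [gE Hg]] := ccellP c.
have cf : ccell c f by exists p.
have [q [qP qh]] : ccell c h by apply/Hg; apply: in_cell_trans fh; apply/Hg.
exists q; split=> //; apply/Fab; split=> //.
have [e [e0 [rD _]]] := in_cell_reflect geo lab fE fh.
have rP : cpoly (fun i => (1 + e) * p i + - e * q i).
  have -> : cpoly (fun i => (1 + e) * p i + - e * q i) = Delta d (fun x => f x + e * (f x - h x)).
    congr Defs.Delta; apply: functional_extensionality => x.
    by rewrite cchart_comb; [rewrite /= in qh; rewrite pf qh; lra|lra].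
  exact: rD.
have := ab _ rP; rewrite dot_comb pb; have := ab _ qP; nra.
Qed.

Lemma cell_inter_is_face (c c' : cell_data d) : (exists f, ccell c f /\ ccell c' f) ->
  exists F, is_face (cpoly (c := c)) F /\
    forall f, (ccell c f /\ ccell c' f) <-> exists p, F p /\ cchart p = f.
Proof.
move=> ne; have [g [gE Hg]] := ccellP c; have [g' [gE' Hg']] := ccellP c'.
have [f []//|f1 f2 [h1 h2] [h3 h4]|//|f [[cf cf'] [fE fmin]]] :=
    @midpoint_closed_is_cell c (fun f => ccell c f /\ ccell c' f).
  by split; [apply/Hg|apply/Hg']; apply: in_cell_mid; (apply/Hg || apply/Hg').
have [F [FF HF]] := subcell_is_face cf; exists F; split=> // h.
rewrite -HF; split=> [[h1 h2]|fh]; first exact: fmin.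
by split; [apply/Hg|apply/Hg']; apply: in_cell_trans fh; [apply/Hg|apply/Hg'].
Qed.

(** The center of a cell may be far from [f0]. Moved towards [h] until its distance from [h] is at
    most [M / (M + 1)], it keeps its tight pairs and comes within [K + 1] of [f0]. *)
Lemma finitely_many_cells (f0 : X -> R) (K : R) : exists l : list (cell_data d),
  forall c : cell_data d, (exists h, ccell c h /\ forall x, Rabs (h x - f0 x) <= K) ->
  exists c', In c' l /\ forall h, ccell c h <-> ccell c' h.
Proof.
have [lg [_ Hlg]] := finite_tight_sets geo lab f0 (K + 1).
have [c [h [ch hK]]|l [_ Hl]] := @finite_reps (cell_data d) (X -> R)
    (fun c : cell_data d => exists h, ccell c h /\ forall x, Rabs (h x - f0 x) <= K)
    (fun (c : cell_data d) g => forall h, ccell c h <-> in_cell d g h) lg.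
  have [g [gE Hg]] := ccellP c; have gh : in_cell d g h by apply/Hg.
  have [M [M0 HM]] := EX_bounded geo gE (in_cell_EX geo lab gE gh).
  have s0 : 0 < / (M + 1) by apply: Rinv_0_lt_compat; lra.
  have s1 : / (M + 1) * (M + 1) = 1 by field; lra.
  have [|sE sT] := @in_cell_segment _ _ geo lab g h (/ (M + 1)) gE gh; first by nra.
  have [|g' [g'l T]] := Hlg _ sE.
    move=> x; have /Rabs_le_inv h1 := HM x; have /Rabs_le_inv h2 := hK x.
    by apply: Rabs_le; nra.
  exists g'; split=> // u; rewrite Hg; split=> -[uD uH]; split=> // x y e; apply: uH.
    by apply/sT/T.
  by apply/T/sT.
exists l => c cK; have [c' [g [c'l [_ [T T']]]]] := Hl c cK.
by exists c'; split=> // h; rewrite T T'.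
Qed.

End Space.

(** * Properness *)

Fixpoint tn_of (n : nat) : Rn n -> Tn n R :=
  match n with
  | 0%N => fun _ => tt
  | m.+1 => fun p => (p ord0, tn_of (fun i => p (lift ord0 i)))
  end.

Fixpoint of_tn (n : nat) : Tn n R -> Rn n :=
  match n with
  | 0%N => fun _ _ => 0
  | m.+1 => fun t i => if unlift ord0 i is Some j then of_tn t.2 j else t.1
  end.

Lemma bounded_tn_of (n : nat) (K : R) (p : Rn n) : (forall i, Rabs (p i) <= K) ->
  bounded_n n (tn_of (fun _ => - K)) (tn_of (fun _ => K)) (tn_of p).
Proof.
elim: n p => [//|n IH] p H /=; split; first exact: Rabs_le_inv.
by apply: IH => i; apply: H.
Qed.

Lemma close_of_tn (n : nat) (e : R) (p : Rn n) (t : Tn n R) : close_n n e (tn_of p) t ->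
  forall i, Rabs (p i - of_tn t i) < e.
Proof.
elim: n p t => [|n IH] p t /=; first by move=> _ [].
case: t => t1 t2 [h1 /IH h2] i; case: (unliftP ord0 i) => [j|] -> //=.
Qed.

(** Compactness of a box in gauge form: the radius may vary with the center. *)
Lemma box_gauge (n : nat) (K : R) (delta : Rn n -> R) : (forall t, 0 < delta t) ->
  exists l : list (Rn n), forall p, (forall i, Rabs (p i) <= K) ->
    exists t, In t l /\ forall i, Rabs (p i - t i) < delta t.
Proof.
move=> H; have /NNPP [l Hl] := @compactness_list n (tn_of (fun _ : 'I_n => - K)) (tn_of (fun _ => K))
  (fun t => mkposreal _ (H (of_tn t))).
exists (map (@of_tn n) l) => p /bounded_tn_of/Hl [t [tl [_ /close_of_tn h]]].
by exists (of_tn t); split=> //; apply: in_map.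
Qed.

Section Space.

Variables (X : Type) (d : X -> X -> nat).
Notation D x y := (INR (d x y)).
Hypothesis geo : discretely_geodesic d.
Hypothesis lab : same_cone_labels d.

Lemma Edist_bound (f g : X -> R) : EX d f -> EX d g -> forall x, Rabs (f x - g x) <= Edist f g.
Proof. by move=> fE gE; have [M [_ HM]] := EX_bounded geo fE gE; apply: (le_supd HM).2. Qed.

(** The gauge at [t] keeps the chart inside one open set of the cover if [t] maps into [S], outside
    [S] if [t] is another point of the polytope, and avoids the polytope otherwise. *)
Lemma cell_subcover (c : cell_data d) (S : (X -> R) -> Prop) (J : Type) (U : J -> (X -> R) -> Prop) :
  m_closed (EX d) (@Edist X) S -> (forall i, m_open (EX d) (@Edist X) (U i)) ->
  (forall f, S f -> exists i, U i f) ->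
  exists l : list J, forall f, S f -> ccell c f -> exists i, In i l /\ U i f.
Proof.
move=> [SE Scl] Uop cov.
have near (t : Rn (cdim c)) : exists q : R * list J, 0 < q.1 /\ forall p, cpoly p ->
    (forall i, Rabs (p i - t i) < q.1) -> S (cchart p) -> exists i, In i q.2 /\ U i (cchart p).
  have small e p : 0 < e -> (forall i, Rabs (p i - t i) < e / 2) -> linf t p < e.
    move=> e0 h; suff : linf t p <= e / 2 by lra.
    by apply: supd_le => [|i]; [lra|rewrite Rabs_minus_sym; apply: Rlt_le].
  have [tP|tP] := classic (cpoly t).
    have tE := cpoly_EX tP; have [St|nSt] := classic (S (cchart t)).
      have [i Ui] := cov _ St; have [_ /(_ _ Ui) [e [e0 He]]] := Uop i.
      exists (e / 2, i :: nil); split=> [/=|p pP /= h _]; first lra.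
      exists i; split; first by left.
      by apply: He; [exact: cpoly_EX|rewrite cchart_dist; exact: small].
    have [e [e0 He]] := Scl _ tE nSt.
    exists (e / 2, nil); split=> [/=|p pP /= h Sp]; first lra.
    case: (He _ (cpoly_EX pP)) => //.
    by rewrite cchart_dist; exact: small.
  have [x nx] := not_all_ex_not _ _ tP; have [y ny] := not_all_ex_not _ _ nx.
  pose e := D x y - (cchart t x + cchart t y).
  (* A violated inequality of excess [e] involves two signed coordinates, each moved by less than
     [e / 2]; the second halving turns strict coordinate bounds into a strict bound on [linf]. *)
  exists (e / 2 / 2, nil); split=> [/=|p pP /= h _]; first by rewrite /e; lra.
  have : linf t p < e / 2 by apply: small => //; rewrite /e; lra.
  have /Rabs_le_inv := sval_linf (typ c x) t p; have /Rabs_le_inv := sval_linf (typ c y) t p.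
  by have := pP x y; rewrite /e /cchart /affine_chart; lra.
pose q t := proj1_sig (constructive_indefinite_description _ (near t)).
have q0 t : 0 < (q t).1 by rewrite /q; case: constructive_indefinite_description => ? [].
have qP t p : cpoly p -> (forall i, Rabs (p i - t i) < (q t).1) -> S (cchart p) ->
    exists i, In i (q t).2 /\ U i (cchart p).
  by rewrite /q; case: constructive_indefinite_description => ? [_ h] /=; apply: h.
have [lt Hlt] := box_gauge (INR #|{: signed (cdim c)}|) q0.
exists (flat_map (fun t => (q t).2) lt) => f Sf [p [pP pf]].
have [t [tl Ht]] := Hlt p (fun i => cpoly_bound geo i pP).
have [|i [iq Ui]] := qP t p pP Ht; first by rewrite /= in pf; rewrite pf.
by exists i; rewrite -pf; split=> //; apply/in_flat_map; exists t.
Qed.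

(** A bounded set meets only finitely many cells, and each of them needs a finite subcover for its
    part of the set. *)
Lemma EX_proper : m_proper (EX d) (@Edist X).
Proof.
move=> S SE [c0 [r [c0E Hr]]] Scl; split=> // J U Uop cov.
have [lc Hlc] := finitely_many_cells geo lab c0 r.
have [l Hl] : exists l : list J, forall c, In c lc -> forall f, S f -> ccell c f ->
    exists i, In i l /\ U i f.
  elim: {Hlc} lc => [|c lc [l Hl]]; first by exists nil.
  have [l' Hl'] := cell_subcover c Scl Uop cov.
  exists (l' ++ l)%list => k [<-|kl] f Sf kf.
    by have [i [il Ui]] := Hl' f Sf kf; exists i; split=> //; apply: in_or_app; left.
  by have [i [il Ui]] := Hl k kl f Sf kf; exists i; split=> //; apply: in_or_app; right.
exists l => f Sf; have fE := SE f Sf; have [c Hc] := exists_cell geo lab fE.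
have cf : ccell c f by apply/Hc; exact: in_cell_refl.
have [|c' [c'l e]] := Hlc c; last by apply: (Hl c') => //; apply/e.
exists f; split=> // x; rewrite Rabs_minus_sym.
by apply: Rle_trans (Hr f Sf); exact: Edist_bound.
Qed.

Lemma hull_complex : polyhedral_complex (EX d) (@Edist X) (@cpoly X d) (@cchart X d).
Proof.
split=> [c|].
  split; first by have [L [_ HL]] := cpoly_vertices geo c; exists L.
  split; first exact: interior.
  by split=> [p|p q _ _]; [exact: cpoly_EX|exact: cchart_dist].
split=> [f fE|].
  by have [c Hc] := exists_cell geo lab fE; exists c; apply/Hc; exact: in_cell_refl.
by split=> [c F|c c']; [exact: face_is_cell|exact: cell_inter_is_face].
Qed.

Lemma hull_locally_finite : locally_finite (EX d) (@Edist X) (@cpoly X d) (@cchart X d).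
Proof.
move=> f fE; have [l Hl] := finitely_many_cells geo lab f 1.
exists 1; split; first lra.
exists l => c [h [hE [fh ch]]]; apply: Hl; exists h; split=> // x.
by rewrite Rabs_minus_sym; have := Edist_bound fE hE x; lra.
Qed.

End Space.

Theorem injective_hull_complex (X : Type) (d : X -> X -> nat) (beta : R) :
  discretely_geodesic d -> bounded_finite d -> stable_intervals d beta ->
  m_proper (EX d) (@Edist X) /\
  exists (J : Type) (dim : J -> nat) (poly : forall j, Rn (dim j) -> Prop)
         (chart : forall j, Rn (dim j) -> (X -> R)),
    polyhedral_complex (EX d) (@Edist X) poly chart /\
    locally_finite (EX d) (@Edist X) poly chart /\
    (forall j, injective_space (poly j) (@linf (dim j))) /\
    (forall n, exists l : list J, forall j, dim j = n ->
       exists k, In k l /\ isometric (@Edist X) (cell poly chart j) (cell poly chart k)).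
Proof.
move=> geo bf st; have lab := stable_same_cone_labels geo bf st.
split; first exact: EX_proper.
exists (cell_data d), (@cdim X d), (@cpoly X d), (@cchart X d).
split; first exact: hull_complex.
split; first exact: hull_locally_finite.
by split=> [c|n]; [exact: cpoly_injective|exact: finitely_many_isometry_types].
Qed.

End Hull.

Theorem theorem1p1 (X : Type) (d : X -> X -> nat) (beta : R) :
  discretely_geodesic d ->
  bounded_finite d ->
  (0 <= beta)%R ->
  stable_intervals d beta ->
  m_proper (EX d) (@Edist X) /\
  exists (J : Type) (dim : J -> nat) (poly : forall j, Rn (dim j) -> Prop)
         (chart : forall j, Rn (dim j) -> (X -> R)),
    polyhedral_complex (EX d) (@Edist X) poly chart /\
    locally_finite (EX d) (@Edist X) poly chart /\
    (forall j, injective_space (poly j) (@linf (dim j))) /\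
    (forall n, (1 <= n)%nat ->
       exists l : list J, forall j, dim j = n ->
         exists k, In k l /\ isometric (@Edist X) (cell poly chart j) (cell poly chart k)).
Proof.
intros geo bf _ st.
destruct (Hull.injective_hull_complex geo bf st)
  as [proper [J [dim [poly [chart [complex [fin [inj types]]]]]]]].
split; [exact proper|].
exists J, dim, poly, chart.
split; [exact complex|]; split; [exact fin|]; split; [exact inj|].
intros n _; exact (types n).
Qed.
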